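(* Let $d > 1$ and let $X$ be a nonempty $\mathbb{Z}^d$ subshift that has the D*-condition and does not consist of a single fixed point. Then there exists a factor map $\phi$ from $X$ onto a $\mathbb{Z}^d$ subshift $\phi(X)$ such that $h(\phi(X)) > 0$ and $\phi(X)$ is not intrinsically ergodic.
   Context: For a finite alphabet $A$, $A^{\mathbb{Z}^d}$ carries the product of discrete topologies and the shift action $(\sigma_t x)(s) = x(s+t)$, $s,t\in\mathbb{Z}^d$. A $\mathbb{Z}^d$ subshift is a closed shift-invariant subset of $A^{\mathbb{Z}^d}$. For $x\in A^{\mathbb{Z}^d}$ and $S\subset\mathbb{Z}^d$, $x(S)$ denotes the restriction of $x$ to $S$. D*-condition: a $\mathbb{Z}^d$ subshift $X$ has the D*-condition if for every $n$ there exists $k_n$ such that for all $x,y \in X$ there is $z \in X$ with $z([-n,n]^d) = x([-n,n]^d)$ and $z(\mathbb{Z}^d \setminus [-(k_n + n), k_n + n]^d) = y(\mathbb{Z}^d \setminus [-(k_n + n), k_n + n]^d)$. A factor map is a continuous shift-commuting map from a $\mathbb{Z}^d$ subshift onto a $\mathbb{Z}^d$ subshift (possibly over a different finite alphabet). $L_S(X)$ is the set of patterns in $A^S$ ($S$ finite) that appear in points of $X$, and the topological entropy is $h(X)=\lim_{n_1,\dots,n_d\to\infty}\frac{1}{\prod_i n_i}\log|L_{\prod_i[1,n_i]}(X)|$. For a shift-invariant Borel probability measure $\mu$ on $X$, $h(\mu)=\lim_{N\to\infty}\frac{1}{N^d}\sum_{w\in L_{[1,N]^d}(X)}-\mu([w])\log\mu([w])$.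 A measure of maximal entropy for $X$ is a shift-invariant Borel probability measure $\mu$ on $X$ with $h(\mu)=h(X)$. $X$ is intrinsically ergodic if it has exactly one measure of maximal entropy. *)

(* Defs.v *)
From HB Require Import structures.
From mathcomp Require Import all_boot all_order all_algebra.
From mathcomp Require Import finmap.
From mathcomp Require Import all_classical all_reals all_analysis.

Set Implicit Arguments.
Unset Strict Implicit.
Unset Printing Implicit Defensive.

Import Order.TTheory GRing.Theory Num.Theory.
Import numFieldNormedType.Exports.

Local Open Scope classical_set_scope.
Local Open Scope ring_scope.

(* A point is only needed because measurable types are pointed: every nonempty
   finite alphabet is of this form. *)
#[short(type="finPointedType")]
HB.structure Definition FinPointed := {A of Finite A & Pointed A}.

Notation config d A := {ptws 'rV[int]_d -> discrete_topology A}.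

Definition shift_action (d : nat) (A : finType) (t : 'rV[int]_d)
    (x : config d A) : config d A := fun s => x (s + t).

Definition is_subshift (d : nat) (A : finType) (X : set (config d A)) : Prop :=
  closed X /\ forall t x, X x -> X (shift_action t x).

Definition cube (d : nat) (n : nat) : set 'rV[int]_d :=
  [set s | forall i, - n%:Z <= s ord0 i <= n%:Z].

Definition Dstar_condition (d : nat) (A : finType) (X : set (config d A)) :
    Prop :=
  forall n : nat, exists k : nat, forall x y, X x -> X y ->
    exists z, [/\ X z, forall s, cube n s -> z s = x s
      & forall s, ~ cube (k + n)%N s -> z s = y s].

Definition is_factor_map (d : nat) (A B : finType) (X : set (config d A))
    (Y : set (config d B)) (phi : config d A -> config d B) : Prop :=
  [/\ is_subshift X, is_subshift Y, {within X, continuous phi},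
      forall t x, X x -> phi (shift_action t x) = shift_action t (phi x)
    & phi @` X = Y].

(* The patterns of shape S appearing somewhere in a point of X; the translate
   is redundant when X is a subshift. *)
Definition language (d : nat) (A : finType) (S : {fset 'rV[int]_d})
    (X : set (config d A)) : {set {ffun S -> A}} :=
  [set w : {ffun S -> A} |
    `[< exists x t, X x /\ forall s : S, x (val s + t) = w s >]]%SET.

Definition box (d : nat) (n : 'I_d -> nat) : {fset 'rV[int]_d} :=
  fset_set [set s : 'rV[int]_d | forall i, 1 <= s ord0 i <= (n i)%:Z].

Lemma mem_box (d : nat) (n : 'I_d -> nat) (s : 'rV[int]_d) :
  reflect (forall i, 1 <= s ord0 i <= (n i)%:Z) (s \in box n).
Proof.
have fin : finite_set [set s : 'rV[int]_d | forall i, 1 <= s ord0 i <= (n i)%:Z].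
  pose M := (\max_i n i).+1.
  pose g (f : {ffun 'I_d -> 'I_M}) : 'rV[int]_d := \row_i (f i : nat)%:Z.
  apply: (@sub_finite_set _ _ [set g f | f in setT]).
    move=> v v_box; have vM i : (absz (v ord0 i) < M)%N.
      have /andP[v1 vn] := v_box i.
      have v0 : 0 <= v ord0 i by exact: le_trans v1.
      by rewrite ltnS (leq_trans _ (leq_bigmax i))// -lez_nat gez0_abs.
    exists [ffun i => Ordinal (vM i)] => //.
    apply/rowP => i; rewrite mxE ffunE /= gez0_abs//.
    by have /andP[v1 _] := v_box i; exact: le_trans v1.
  exact: finite_image.
apply: (iffP idP); first by rewrite in_fset_set// inE.
by move=> s_box; rewrite in_fset_set// inE.
Qed.

Definition all_to_oo (d : nat) : set_system ('I_d -> nat) :=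
  filter_from setT (fun N : nat => [set n | forall i, (N <= n i)%N]).
Arguments all_to_oo : clear implicits.

#[global] Instance all_to_oo_filter (d : nat) : ProperFilter (all_to_oo d).
Proof.
apply: filter_from_proper; last by move=> N _; exists (fun=> N).
apply: filter_from_filter; first by exists 0%N.
move=> M N _ _; exists (maxn M N) => // n n_ge; split=> i;
  by apply: leq_trans (n_ge i); rewrite ?leq_maxl ?leq_maxr.
Qed.

Definition top_entropy (R : realType) (d : nat) (A : finType)
    (X : set (config d A)) : R :=
  lim ((fun n : 'I_d -> nat =>
          (\prod_i (n i)%:R)^-1 * ln (#|language (box n) X|%:R : R))
       @ all_to_oo d).

Notation borel_config d A := (g_sigma_algebraType (@open (config d A))).

Definition cylinder (d : nat) (A : finType) (S : {fset 'rV[int]_d})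
    (w : {ffun S -> A}) : set (config d A) :=
  [set x | forall s : S, x (val s) = w s].

(* A Borel measure on X is represented by its extension by zero to the full
   shift. *)
Definition is_invariant_probability (R : realType) (d : nat)
    (A : finPointedType) (X : set (config d A))
    (mu : probability (borel_config d A) R) : Prop :=
  mu X = 1%E /\
  forall (t : 'rV[int]_d) (E : set (borel_config d A)), measurable E ->
    mu (shift_action t @^-1` E) = mu E.

Definition measure_entropy (R : realType) (d : nat) (A : finPointedType)
    (X : set (config d A)) (mu : probability (borel_config d A) R) : R :=
  lim ((fun N : nat =>
          (N%:R ^+ d)^-1 *
          \sum_(w in language (box (fun _ : 'I_d => N)) X)
             - (fine (mu (cylinder w)) * ln (fine (mu (cylinder w)))))
       @ \oo).

Definition is_measure_of_maximal_entropy (R : realType) (d : nat)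
    (A : finPointedType) (X : set (config d A))
    (mu : probability (borel_config d A) R) : Prop :=
  is_invariant_probability X mu /\ measure_entropy X mu = top_entropy R X.

(* Measures are compared on Borel sets only: as functions on the whole powerset
   they are unconstrained outside the sigma-algebra. *)
Definition intrinsically_ergodic (R : realType) (d : nat)
    (A : finPointedType) (X : set (config d A)) : Prop :=
  exists mu : probability (borel_config d A) R,
    is_measure_of_maximal_entropy X mu /\
    forall nu : probability (borel_config d A) R,
      is_measure_of_maximal_entropy X nu ->
      forall E : set (borel_config d A), measurable E -> nu E = mu E.

(* Main.v *)
(** The factor is a Widom-Rowlinson model: configurations over {empty, +, -} in
    which spins are N apart and opposite spins are 2c apart.  X maps onto it
    because the D*-condition lets one insert, at any N-separated set of sites,
    markers that occur nowhere else.

    An empty cube of side c can be filled by a + spin in q ways, provided that the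
    clusters of spins around it, at most one per orthant, are made + first.  Hence
    k disjoint cubes are simultaneously empty in at most a fraction kappa^k of the
    patterns, kappa = 2^(2^d)/q, and by Gibbs' inequality a measure of maximal
    entropy gives this event probability at most 2 kappa^k.  Two cubes with
    different signs are separated, in a coordinate plane, by a long path of empty
    cubes, so by a Peierls estimate any two cubes have the same sign with
    probability close to 1, uniformly in their distance.

    Conditionally on the sign of the cube at s, flip all spins or not so that this
    cube becomes +, respectively -; average over s in growing boxes and pass to a
    limit along an ultrafilter.  The two limits are invariant, dominated by mu plus
    its flip, hence of maximal entropy, and concentrated near opposite signs at the
    origin: they are not equal. *)

From HB Require Import structures.
Require Import Defs.
From mathcomp Require Import all_boot all_order all_algebra.
From mathcomp Require Import finmap zify ring lra.
From mathcomp Require Import all_classical all_reals all_analysis.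

Set Implicit Arguments.
Unset Strict Implicit.
Unset Printing Implicit Defensive.

Import Order.TTheory GRing.Theory Num.Theory.
Import numFieldNormedType.Exports.

Local Open Scope classical_set_scope.
Local Open Scope ring_scope.

(** * Topology of the full shift *)

(** The D*-condition says nothing about the collar between a patch and its background, so a marker
    might arise there by accident. The arms answer this: an accidental marker must lie close to a
    real one, and the overlap of their two cores then forces the two to coincide. The distance [N]
    that this costs depends on [X] and cannot be tuned. The distance [b] between opposite spins can:
    conflicting spins are simply deleted, so [b] is chosen after [N], as large as desired. A large
    cube then offers many more places for a spin than there are sign records to forget, which makes
    [kappa] small whatever [N] is. A measure of maximal entropy is known only through its entropy,
    without any Gibbs property. Counts of patterns are transferred to it by tiling a large box with
    translates of the unlikely event and giving weight 2 to each occurrence. No such measure has to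
    be constructed from scratch: intrinsic ergodicity supplies one, and the others are derived from
    it. *)

Lemma nbhs_agree (d : nat) (A : finType) (x : config d A)
    (F : seq 'rV[int]_d) :
  nbhs x [set y : config d A | forall s, s \in F -> y s = x s].
Proof.
elim: F => [|a F IH]; first by apply: filterS (@filterT _ (nbhs x) _).
have Ha : nbhs x [set y : config d A | y a = x a].
  apply: (@proj_continuous _ (fun _ => discrete_topology A) a x [set x a]).
  exact: (@discrete_set1 (discrete_topology A)).
apply: filterS (filterI Ha IH) => y [ya yF] s; rewrite inE => /predU1P[->//|].
exact: yF.
Qed.

Definition finitary (d : nat) (A : finType) (E : set (config d A)) :=
  exists F : seq 'rV[int]_d,
    forall x y : config d A, (forall s, s \in F -> y s = x s) -> E x -> E y.

Lemma finitary_open (d : nat) (A : finType) (E : set (config d A)) :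
  finitary E -> open E.
Proof.
move=> [F EF]; rewrite openE => x Ex; rewrite /interior.
by apply: filterS (nbhs_agree x F) => y /EF; apply.
Qed.

Lemma cvg_config (d : nat) (A : finType) (G : set_system (config d A))
    (z : config d A) : Filter G ->
  (forall s, G [set y | y s = z s]) -> G --> z.
Proof.
move=> FG Gz; apply/cvg_sup => s; rewrite cvg_image; last first.
  by rewrite eqEsubset; split=> v // _; exists (fun=> v).
move=> W /(@principal_filterP (discrete_topology A)) Wz.
exists ((fun y : config d A => y s) @^-1` W); last first.
  by rewrite eqEsubset; split=> [_ [y ? <-]//|v Wv]; exists (fun=> v).
by apply: filterS (Gz s) => y /= ->.
Qed.

Lemma closed_agree (d : nat) (A : finType) (X : set (config d A))
    (z : config d A) : closed X ->
  (forall F : seq 'rV[int]_d,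
     exists x, X x /\ forall s, s \in F -> x s = z s) ->
  X z.
Proof.
move=> clX happ.
pose G := filter_from [set: seq 'rV[int]_d]
  (fun F => [set y : config d A | X y /\ forall s, s \in F -> y s = z s]).
have FG : ProperFilter G.
  apply: filter_from_proper; last by move=> F _; have [x ?] := happ F; exists x.
  apply: filter_from_filter; first by exists [::].
  move=> F1 F2 _ _; exists (F1 ++ F2) => // y [Xy yF].
  by split; split=> // s sF; apply: yF; rewrite mem_cat sF ?orbT.
have Gz : G --> z.
  by apply: cvg_config => s; exists [:: s] => // y [_ ys]; apply: ys; rewrite inE.
apply: (@closed_cvg _ _ G FG id X clX _ z Gz).
by exists [::] => // y [].
Qed.

Lemma finitary_continuous (d : nat) (A B : finType)
    (phi : config d A -> config d B) :
  (forall s, exists F : seq 'rV[int]_d,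
     forall x y : config d A, (forall t, t \in F -> y t = x t) ->
     phi y s = phi x s) ->
  continuous phi.
Proof.
move=> loc x.
apply: (@cvg_config _ _ (phi @ nbhs x) (phi x)) => s.
have [F HF] := loc s; rewrite /fmap /=.
by apply: filterS (nbhs_agree x F) => y /HF.
Qed.

(** * Sup-distance on the lattice *)

Lemma row_ext (d : nat) (s t : 'rV[int]_d) :
  (forall i, s ord0 i = t ord0 i) -> s = t.
Proof. by move=> st; apply/rowP => i; exact: st. Qed.

Lemma rowD (d : nat) (s t : 'rV[int]_d) (i : 'I_d) :
  (s + t) ord0 i = s ord0 i + t ord0 i :> int.
Proof. by rewrite mxE. Qed.

Lemma rowN (d : nat) (s : 'rV[int]_d) (i : 'I_d) :
  (- s) ord0 i = - s ord0 i :> int.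
Proof. by rewrite mxE. Qed.

Lemma row0 (d : nat) (i : 'I_d) : (0%R : 'rV[int]_d) ord0 i = 0%R :> int.
Proof. by rewrite mxE. Qed.

Lemma rowE (d : nat) (f : 'I_d -> int) (i : 'I_d) :
  (\row_j f j) ord0 i = f i :> int.
Proof. by rewrite mxE. Qed.

Definition rwE := (rowD, rowN, row0, rowE).

Definition nearb (d k : nat) (s t : 'rV[int]_d) : bool :=
  [forall i, (absz (s ord0 i - t ord0 i)%R < k)%N].

Lemma nearbC (d k : nat) (s t : 'rV[int]_d) : nearb k s t = nearb k t s.
Proof. by apply: eq_forallb => i; rewrite -abszN opprB. Qed.

Lemma nearb_trans (d k l m : nat) (t s u : 'rV[int]_d) :
  nearb k s t -> nearb l t u -> (k + l <= m.+1)%N -> nearb m s u.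
Proof.
move=> /forallP st /forallP tu klm; apply/forallP => i.
by have := st i; have := tu i; lia.
Qed.

Lemma nearb_add (d k : nat) (v s t : 'rV[int]_d) :
  nearb k (s + v) (t + v) = nearb k s t.
Proof. by apply: eq_forallb => i; rewrite !rwE opprD addrACA subrr addr0. Qed.

Lemma nearb_leq (d k l : nat) (s t : 'rV[int]_d) :
  (k <= l)%N -> nearb k s t -> nearb l s t.
Proof.
by move=> kl /forallP st; apply/forallP => i; apply: leq_trans (st i) kl.
Qed.

Lemma nearb_refl (d k : nat) (s : 'rV[int]_d) : nearb k.+1 s s.
Proof. by apply/forallP => i; rewrite subrr. Qed.

Lemma nearb_seq (d k : nat) (s : 'rV[int]_d) :
  exists l : seq 'rV[int]_d, forall t, nearb k t s -> t \in l.
Proof.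
exists [seq s + \row_i ((f i)%:Z - k%:Z) |
        f : {ffun 'I_d -> 'I_(k + k).+1} <- enum {ffun 'I_d -> 'I_(k + k).+1}].
move=> t /forallP ts; apply/mapP.
exists [ffun i => inord (absz (t ord0 i - s ord0 i + k%:Z))].
  by rewrite mem_enum.
apply: row_ext => i; rewrite !rwE ffunE inordK; have := ts i; lia.
Qed.

Lemma cubeP (d n : nat) (s : 'rV[int]_d) : cube n s <-> nearb n.+1 s 0.
Proof.
split=> [cs|/forallP cs].
  by apply/forallP => i; have := cs i; rewrite rwE; lia.
by move=> i; have := cs i; rewrite rwE; lia.
Qed.

(** * Gluing and markers *)

(** The D*-condition recentred at an arbitrary site: the origin of [x] is carried to [c], and a
    collar of width [k n] is left uncontrolled. *)
Definition patchable (d : nat) (A : finType) (X : set (config d A))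
    (k : nat -> nat) := forall n c x y, X x -> X y ->
  exists z, [/\ X z, forall s, nearb n.+1 s c -> z s = x (s - c)
    & forall s, ~~ nearb (k n + n).+1 s c -> z s = y s].

Lemma Dstar_patchable (d : nat) (A : finType) (X : set (config d A)) :
  is_subshift X -> Dstar_condition X -> exists k, patchable X k.
Proof.
move=> [_ Xinv] /choice[k Hk]; exists k => n c x y Xx Xy.
have [z [Xz zx zy]] := Hk n x (shift_action c y) Xx (Xinv _ _ Xy).
exists (shift_action (- c) z); split; first exact: Xinv.
  move=> s sc; rewrite /shift_action zx//; apply/cubeP.
  by rewrite -(nearb_add _ c) subrK add0r.
move=> s sc; rewrite /shift_action zy.
  by rewrite /shift_action subrK.
by move=> /cubeP; rewrite -(nearb_add _ c) subrK add0r; apply/negP.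
Qed.

(** Separation only asks that the collar of one patch miss the core of every other. Collars may
    overlap each other, since nothing is claimed there. The bound [b] on their size makes the limit
    of infinitely many insertions exist, and closedness keeps it in [X]. *)
Lemma patch_many (d : nat) (A : finType) (X : set (config d A)) (k : nat -> nat)
    (C : set 'rV[int]_d) (r : 'rV[int]_d -> nat)
    (src : 'rV[int]_d -> config d A) (y : config d A) (b : nat) :
  closed X -> patchable X k -> X y -> (forall c, C c -> X (src c)) ->
  (forall c, C c -> (k (r c) + r c < b)%N) ->
  (forall c c', C c -> C c' -> c <> c' ->
     ~~ nearb (k (r c) + r c + r c').+1 c c') ->
  exists z, [/\ X z,
    forall c s, C c -> nearb (r c).+1 s c -> z s = src c (s - c)
    & forall s, (forall c, C c -> ~~ nearb (k (r c) + r c).+1 s c) ->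
        z s = y s].
Proof.
move=> clX pX Xy Xsrc rb sep.
have /choice[p Hp] (cx : 'rV[int]_d * config d A) : exists z,
    X cx.2 -> C cx.1 ->
    [/\ X z, forall s, nearb (r cx.1).+1 s cx.1 -> z s = src cx.1 (s - cx.1)
     & forall s, ~~ nearb (k (r cx.1) + r cx.1).+1 s cx.1 -> z s = cx.2 s].
  case: cx => c x /=; have [[Cc Xx]|nCX] := pselect (C c /\ X x).
    by have [z ?] := pX (r c) c _ _ (Xsrc c Cc) Xx; exists z.
  by exists x => Xx Cc; case: nCX.
(* The patches are inserted one after the other along an enumeration of Z^d;
   each site is modified finitely often. *)
pose step i x := if pickle_inv i is Some c then
  if `[< C c >] then p (c, x) else x else x.
pose Z := fix Z i := if i is j.+1 then step j (Z j) else y.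
have XZ i : X (Z i).
  elim: i => [//|i IH] /=; rewrite /step; case: pickle_inv => [c|//].
  by case: asboolP => // Cc; have [] := Hp (c, Z i) IH Cc.
have ZS (i : nat) s : (forall c, C c -> choice.pickle c = i ->
    ~~ nearb (k (r c) + r c).+1 s c) -> Z i.+1 s = Z i s.
  move=> far; rewrite /= /step; case E : pickle_inv => [c|//].
  case: asboolP => // Cc; have [_ _] := Hp (c, Z i) (XZ i) Cc.
  apply; apply: far => //.
  by have := @pickle_invK 'rV[int]_d i; rewrite E.
have stab (i j : nat) s : (i <= j)%N -> (forall c, C c -> (i <= choice.pickle c < j)%N ->
    ~~ nearb (k (r c) + r c).+1 s c) -> Z j s = Z i s.
  move=> ij; rewrite -(subnKC ij); elim: (j - i)%N => [|m IH] far.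
    by rewrite addn0.
  rewrite addnS ZS => [|c Cc pc]; last by apply: far => //; rewrite pc; lia.
  by apply: IH => c Cc pc; apply: far => //; lia.
have HI0 (s : 'rV[int]_d) : exists i : nat, forall c : 'rV[int]_d, nearb b s c -> (choice.pickle c < i)%N.
  have [l Hl] := nearb_seq b s; exists (\max_(c <- l) choice.pickle c).+1 => c.
  by rewrite nearbC => /Hl cl; rewrite ltnS; apply: leq_bigmax_seq.
have [I HI] := choice HI0.
pose z : config d A := fun s => Z (I s) s.
have zE s j : (I s <= j)%N -> Z j s = z s.
  move=> Ij; apply: stab => // c Cc /andP[+ _]; apply: contraL => nsc.
  by rewrite -ltnNge HI// (nearb_leq _ nsc)// rb.
exists z; split.
- apply: closed_agree => // F; exists (Z (\max_(s <- F) I s)); split=> // s sF.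
  by apply: zE; apply: leq_bigmax_seq.
- move=> c s Cc sc; rewrite -(zE s (maxn (I s) (choice.pickle c).+1)) ?leq_maxl//.
  rewrite (stab (choice.pickle c).+1) ?leq_maxr//; last first.
    move=> c' Cc' /andP[cc' _]; apply: contra (sep c' c Cc' Cc _) => [sc'|ecc].
      by apply: nearb_trans sc _; [rewrite nearbC; apply: sc' | lia].
    by move: cc'; rewrite ecc ltnn.
  rewrite /= /step pickleK_inv; case: asboolP => // _.
  by have [_ + _] := Hp (c, Z (choice.pickle c)) (XZ _) Cc; apply.
- move=> s far; rewrite /z (stab 0%N)// => c Cc _; exact: far.
Qed.

Lemma rowM (d : nat) (s : 'rV[int]_d) (m : nat) (i : 'I_d) :
  (s *+ m) ord0 i = m%:Z * s ord0 i :> int.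
Proof. by rewrite mulmxnE -mulr_natl natz. Qed.

(** If all points of [X] had the same symbol at the origin, invariance would reduce [X] to one
    constant point. *)
Lemma two_symbols (d : nat) (A : finType) (X : set (config d A)) :
  X !=set0 -> is_subshift X ->
  ~ (exists x : config d A, (forall t, shift_action t x = x) /\ X = [set x]) ->
  exists x y, [/\ X x, X y & x 0 <> y 0].
Proof.
move=> [x Xx] [_ Xinv] nfix; apply: contrapT => same.
have cst y t : X y -> y t = x 0.
  move=> Xy; apply: contrapT => yt; apply: same.
  exists (shift_action t y), x; split=> //; first exact: Xinv.
  by rewrite /shift_action add0r.
apply: nfix; exists x; split.
  by move=> t; apply: funext => s; rewrite /shift_action !cst.
rewrite eqEsubset; split=> [y Xy /=|_ /= -> //].
by apply: funext => s; rewrite !cst.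
Qed.

(** Patches of radius 0 have collars of width [k 0], so on a lattice of larger mesh the symbols can
    be prescribed independently. *)
Lemma lattice_point (d : nat) (A : finType) (X : set (config d A))
    (k : nat -> nat) (x y : config d A) (m : nat) (f : 'rV[int]_d -> bool) :
  closed X -> patchable X k -> X x -> X y -> (k 0 < m)%N ->
  exists z, X z /\
    forall v, z (v *+ m) = if f (v *+ m) then x 0 else y 0.
Proof.
move=> clX pX Xx Xy km.
pose src c := if f c then x else y.
have Xsrc c : X (src c) by rewrite /src; case: ifP.
have [||z [Xz zC _]] := @patch_many d A X k [set v *+ m | v in setT] (fun=> 0%N)
  src x (k 0).+1 clX pX Xx (fun c _ => Xsrc c).
- by move=> c _; rewrite addn0.
- move=> _ _ [v _ <-] [v' _ <-] vv'; apply/negP => /forallP vv.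
  apply: vv'; congr (_ *+ _); apply: row_ext => i; have := vv i.
  by rewrite !rowM; nia.
exists z; split=> // v; rewrite (zC (v *+ m)).
- by rewrite subrr /src; case: ifP.
- by exists v.
- exact: nearb_refl.
Qed.

Section Markers.
Variables (d : nat) (A : finType) (X : set (config d A)) (k : nat -> nat).
Variables (xa xb w : config d A) (a b : A) (K : nat).
Hypotheses (clX : closed X) (pX : patchable X k).
Hypotheses (Xa : X xa) (Xb : X xb) (Xw : X w) (ab : a <> b).
Hypothesis xaE : forall v, xa (v *+ K) = a.
Hypothesis xbE : forall v, xb (v *+ K.+1) = b.
Hypothesis wE : forall v, w (v *+ K) = if v *+ K == 0 then a else b.
Hypothesis K0 : (0 < K)%N.
Hypothesis d0 : (0 < d)%N.

(* A marker at t consists of a copy of w around t and of copies of xa, the arms,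
   far away from t in both directions of each axis.  The part on the diagonal is a
   copy of xa or xb whose symbol at the centre, a or b, encodes the spin. *)
Let n := (K * K)%N.
(** [T] bounds the displacement of an accidental marker from a real one. The core radius [n1] leaves
    room for [K] such displacements, and [D] exceeds a core with its collar plus another core, so
    that parts [D] apart do not interfere. *)
Let T := (n + n + k n)%N.
Let n1 := (K * T + n)%N.
Let D := (k n + k n1 + n1 + n1).+1.

Let part := option (option (bool * 'I_d)).
Let offset (p : part) : 'rV[int]_d := match p with
  | None => 0
  | Some None => \row_i D%:Z
  | Some (Some (sg, i)) =>
      \row_j (if i == j then (if sg then 1 else -1) * (2 * D%:Z) else 0)
  end.
Let radius (p : part) : nat := if p is None then n1 else n.

Let marker (x : config d A) (t : 'rV[int]_d) :=
  (forall v, nearb n1.+1 v 0 -> x (t + v) = w v) /\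
  (forall i v, nearb n.+1 v 0 -> x (t + offset (Some (Some i)) + v) = xa v).

(* K and K.+1 are coprime, so the lattice of the a's of xa meets every translate of
   the lattice of the b's of xb. *)
Lemma not_recurrent (t : 'rV[int]_d) :
  exists v, [/\ nearb n.+1 v 0, xa v = a & xb (t + v) = b].
Proof.
pose i := \row_j (t ord0 j %% K.+1)%Z : 'rV[int]_d.
pose q := \row_j (t ord0 j %/ K.+1)%Z : 'rV[int]_d.
exists (i *+ K); split; last first.
- rewrite -(xbE (q + i)); congr (xb _); apply: row_ext => j.
  by rewrite !(rwE, rowM) {1}(divz_eq (t ord0 j) K.+1); lia.
- exact: xaE.
apply/forallP => j; rewrite !(rwE, rowM) /n.
have := modz_ge0 (t ord0 j) (isT : (K.+1 : int) != 0).
have := @ltz_pmod (t ord0 j) K.+1 isT.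
nia.
Qed.

Let offset_bound (p : part) (i : 'I_d) : (absz (offset p ord0 i) <= 2 * D)%N.
Proof.
case: p => [[[sg j]|]|] /=; rewrite rwE; last lia; last lia.
by case: ifP => _; case: sg; lia.
Qed.

Lemma offset_sep (s s' : 'rV[int]_d) (p p' : part) :
  (s, p) <> (s', p') -> (s <> s' -> ~~ nearb (11 * D) s s') ->
  ~~ nearb D (s + offset p) (s' + offset p').
Proof.
move=> spn far; apply/negP => /forallP nsp.
have [ess'|/far/negP] := pselect (s = s'); last first.
  apply; apply/forallP => i; have := nsp i; rewrite !rwE.
  by have := offset_bound p i; have := offset_bound p' i; lia.
move: spn nsp; rewrite ess' => spn nsp.
have pp' : p <> p' by move=> e; apply: spn; rewrite e.
have dd (i : 'I_d) : (absz (offset p ord0 i - offset p' ord0 i)%R < D)%N.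
  have := nsp i; rewrite !rwE.
  by rewrite opprD addrACA subrr add0r.
have i0 := Ordinal d0.
move: pp' dd {spn nsp}; case: p => [[[sg i]|]|]; case: p' => [[[sg' i']|]|] //= pp' dd.
- have := dd i; rewrite !rwE eqxx.
  case: eqP => [ei|_]; last by case: (sg); lia.
  move: pp'; rewrite -ei; case: sg sg' {dd} => [] [] // _; lia.
- by have := dd i; rewrite !rwE eqxx; case: (sg); lia.
- by have := dd i; rewrite !rwE eqxx; case: (sg); lia.
- by have := dd i'; rewrite !rwE eqxx; case: (sg'); lia.
- by have := dd i0; rewrite !rwE; lia.
- by have := dd i'; rewrite !rwE eqxx; case: (sg'); lia.
- by have := dd i0; rewrite !rwE; lia.
Qed.

Lemma markers_realized (z : 'rV[int]_d -> option bool) :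
  (forall s t, s <> t -> z s -> z t -> ~~ nearb (11 * D) s t) ->
  exists x, [/\ X x, forall t, marker x t <-> z t
    & forall t c, z t = Some c -> x (t + offset (Some None)) = if c then a else b].
Proof.
move=> zsep.
pose C := [set c | exists sp : 'rV[int]_d * part, z sp.1 /\ c = sp.1 + offset sp.2].
have decP (c : 'rV[int]_d) : exists sp : 'rV[int]_d * part,
    C c -> z sp.1 /\ c = sp.1 + offset sp.2.
  by have [[sp]|nC] := pselect (C c); [exists sp | exists (0, None)].
have [dec decE] := choice decP.
have Csep s s' p p' : z s -> z s' -> (s, p) <> (s', p') ->
    ~~ nearb D (s + offset p) (s' + offset p').
  by move=> zs zs' spn; apply: offset_sep spn _ => /zsep; apply.
have dec_offset s p : z s -> dec (s + offset p) = (s, p).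
  move=> zs; have [|zs' e] := decE (s + offset p); first by exists (s, p).
  apply: contrapT => spn; have := Csep _ (dec (s + offset p)).1 p (dec (s + offset p)).2 zs zs'.
  rewrite -surjective_pairing -e nearb_refl => H; suff: false by [].
  by apply: H => e'; apply: spn; rewrite -e'.
pose r c := radius (dec c).2.
pose src c := match (dec c).2 with
  | None => w
  | Some None => if z (dec c).1 is Some true then xa else xb
  | Some (Some _) => xa
  end.
have Xsrc c : X (src c).
  by rewrite /src; case: (dec c).2 => [[_|]|] //; case: (z _) => [[]|].
have rad p : (k (radius p) + radius p + n1 < D)%N by case: p => [[?|]|] /=; lia.
have rn1 p : (radius p <= n1)%N by case: p => [[?|]|] /=; lia.
have [||x [Xx xC xF]] := @patch_many d A X k C r src xb D.+1 clX pX Xb (fun c _ => Xsrc c).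
- by move=> c _; have := rad (dec c).2; rewrite /r; lia.
- move=> _ _ [[s p] /= [zs ->]] [[s' p'] /= [zs' ->]] cc'.
  rewrite /r !dec_offset//=; apply: contra (Csep s s' p p' zs zs' _).
    by apply: nearb_leq; have := rad p; have := rn1 p'; lia.
  by move=> e; apply: cc'; case: e => -> ->.
have xE s p v : z s -> nearb (radius p).+1 v 0 ->
    x (s + offset p + v) = src (s + offset p) v.
  move=> zs v0; rewrite (xC (s + offset p)); last 2 first.
  - by exists (s, p).
  - by rewrite /r dec_offset//= addrC -[X in nearb _ _ X]add0r nearb_add.
  by rewrite addrAC subrr add0r.
exists x; split=> //.
  move=> t; split=> [[Wt arms]|zt]; last first.
    split=> [v vn|i v vn].
      have := xE t None v zt vn; rewrite /= addr0 /src.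
      by have := dec_offset t None zt; rewrite /= addr0 => ->.
    by rewrite (xE t (Some (Some i)) v zt vn) /src dec_offset.
  (* The arm of a marker cannot lie in the background xb, so it meets a patch; the
     two opposite arms along an axis pin down the coordinate up to T. *)
  have arm sg i : exists2 s, z s &
      (forall j, absz (t ord0 j - s ord0 j)%R <= 5 * D)%N /\
      (if sg then 1 else -1) * (t ord0 i - s ord0 i) <= T%:Z.
    have [v [vn xav xbv]] := not_recurrent (t + offset (Some (Some (sg, i)))).
    have [[c [Cc nc]]|far] := pselect (exists c, C c /\
       nearb (k (r c) + r c).+1 (t + offset (Some (Some (sg, i))) + v) c); last first.
      case: ab; rewrite -xav -(arms (sg, i) v vn) -xbv; apply: xF => c Cc.
      by apply/negP => nc; apply: far; exists c.
    case: Cc nc => -[s p] /= [zs ->]; rewrite /r dec_offset//= => nc.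
    exists s => //; split=> [j|].
      have := forallP nc j; have := forallP vn j.
      have := offset_bound p j; have := offset_bound (Some (Some (sg, i))) j.
      by have := rad p; rewrite !(rowD, rowN, row0); move: (offset (Some (Some (sg, i))) ord0 j) => o; rewrite /n1; lia.
    (* The offset of the arm [(sg, i)] is extreme in its direction. Whichever part [p] is met, [t]
       is therefore displaced from [s] in that direction by at most twice the arm radius plus a
       collar, that is [T]. *)
    have := forallP nc i; have := forallP vn i.
    have := rad p; rewrite !rwE eqxx.
    case: (p) => [[[sg' i']|]|] /=; rewrite ?rwE.
    - by rewrite /T; case: (_ == _); case: (sg); case: (sg'); lia.
    - by rewrite /T; case: (sg); lia.
    - by rewrite /T; case: (sg); lia.
  pose i0 := Ordinal d0.
  have [s zs [s5 _]] := arm true i0.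
  (* Different arms might meet markers at different sites. These all lie within [5 * D] of [t],
     hence within [10 * D] of each other, and the separation [11 * D] makes them equal. *)
  have arm_s sg i : (if sg then 1 else -1) * (t ord0 i - s ord0 i) <= T%:Z.
    have [s' zs' [s5' H]] := arm sg i.
    suff -> : s = s' by [].
    apply: contrapT => /zsep/(_ zs zs')/negP; apply; apply/forallP => j.
    by have := s5 j; have := s5' j; lia.
  have tsT i : (absz (t ord0 i - s ord0 i)%R <= T)%N.
    by have := arm_s true i; have := arm_s false i; lia.
  have [<-//|ts] := eqVneq s t.
  have ws v : nearb n1.+1 v 0 -> x (s + v) = w v.
    move=> vn; have := xE s None v zs vn; rewrite /= addr0 /src.
    by have := dec_offset s None zs; rewrite /= addr0 => ->.
  pose e := t - s.
  have nje j : (j <= K)%N -> nearb n1.+1 (e *+ j) 0.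
    move=> jK; apply/forallP => i; rewrite rowM !rwE.
    have := tsT i; move: (t ord0 i) (s ord0 i) => ti si; rewrite /n1; nia.
  (* Two overlapping copies of w at distance e propagate the symbol a of w at 0 to
     K e, where w has the symbol b. *)
  have chain j : (j <= K)%N -> w (e *+ j) = w 0.
    elim: j => [_|j IH jK]; first by rewrite mulr0n.
    rewrite -IH ?(ltnW jK)// -ws ?nje// mulrS addrA /e (addrC s) subrK.
    by rewrite Wt ?nje// ltnW.
  have w0 : w 0 = a by have := wE 0; rewrite mul0rn eqxx.
  case: ab; rewrite -w0 -(chain K)// wE; case: eqP => // /eqP eK0; case/negP: ts.
  rewrite -subr_eq0 -oppr_eq0 opprB -/e; apply/eqP; apply: row_ext => i.
  move/eqP/(congr1 (fun v : 'rV[int]_d => v ord0 i)): eK0; rewrite rowM !rwE.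
  by move: (t ord0 i) (s ord0 i) K0 => ti si; nia.
move=> t c ztc; have zt : z t by rewrite ztc.
rewrite -[_ + _]addr0 (xE t (Some None) 0 zt) ?nearb_refl//.
rewrite /src dec_offset//= ztc; have := xaE 0; have := xbE 0; rewrite !mul0rn.
by case: c {ztc}.
Qed.

Lemma marker_code : exists (N : nat) (code : config d A -> option bool),
  (exists F : seq 'rV[int]_d, forall x y : config d A,
     (forall s, s \in F -> y s = x s) -> code y = code x) /\
  forall z : 'rV[int]_d -> option bool,
    (forall s t, s <> t -> z s -> z t -> ~~ nearb N s t) ->
    exists x, X x /\ forall t, code (shift_action t x) = z t.
Proof.
pose code (x : config d A) := if `[< marker x 0 >] then
  Some `[< x (offset (Some None)) = a >] else None.
exists (11 * D)%N, code; split.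
  have [F HF] := nearb_seq (4 * D)%N (0%R : 'rV[int]_d).
  exists F => x y xy.
  have nF (o v : 'rV[int]_d) : (forall i : 'I_d, absz (o ord0 i) <= 2 * D)%N ->
      nearb n1.+1 v 0 -> y (o + v) = x (o + v).
    move=> oD vn; apply/xy/HF/forallP => i; have := oD i; have := forallP vn i.
    by rewrite !(rowD, row0); lia.
  have nn1 v : nearb n.+1 v 0 -> nearb n1.+1 v 0 by apply: nearb_leq; lia.
  have o0 (i : 'I_d) : (absz ((0%R : 'rV[int]_d) ord0 i) <= 2 * D)%N.
    by rewrite row0; lia.
  rewrite /code; have -> : marker y 0 = marker x 0.
    rewrite /marker; apply: propext; split=> -[H1 H2].
      split=> [v vn|i v vn]; first by rewrite -nF ?H1.
      by rewrite -(H2 i v vn) !add0r (nF (offset _))// ?nn1// => j; exact: offset_bound.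
    split=> [v vn|i v vn]; first by rewrite nF ?H1.
    by rewrite -(H2 i v vn) !add0r (nF (offset _))// ?nn1// => j; exact: offset_bound.
  suff -> : y (offset (Some None)) = x (offset (Some None)) by [].
  rewrite -[offset _]addr0 nF ?nearb_refl// => j; exact: offset_bound.
move=> z zsep; have [x [Xx mx sx]] := markers_realized zsep.
exists x; split=> // t; rewrite /code.
have -> : marker (shift_action t x) 0 = marker x t.
  rewrite /marker /shift_action; apply: propext.
  split=> -[H1 H2]; split=> [v vn|i v vn].
  - by rewrite addrC -[v in LHS]add0r H1.
  - by rewrite -addrA addrC -[X in X + t]add0r [0 + _]addrA H2.
  - by rewrite add0r addrC H1.
  - by rewrite add0r addrC addrA H2.
case: asboolP => [/mx zt|nm]; last first.
  by case E : (z t) => [c|//]; case: nm; apply/mx; rewrite E.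
case E : (z t) zt => [c|//] _; congr Some.
rewrite /shift_action addrC (sx t c E).
by case: c {E}; case: asboolP => // e; case: ab.
Qed.
End Markers.

Lemma Dstar_code (d : nat) (A : finType) (X : set (config d A)) :
  (0 < d)%N -> X !=set0 -> is_subshift X -> Dstar_condition X ->
  ~ (exists x : config d A, (forall t, shift_action t x = x) /\ X = [set x]) ->
  exists (N : nat) (code : config d A -> option bool),
  (exists F : seq 'rV[int]_d, forall x y : config d A,
     (forall s, s \in F -> y s = x s) -> code y = code x) /\
  forall z : 'rV[int]_d -> option bool,
    (forall s t, s <> t -> z s -> z t -> ~~ nearb N s t) ->
    exists x, X x /\ forall t, code (shift_action t x) = z t.
Proof.
move=> d0 X0 sX DX nfix; have [clX _] := sX.
have [x [y [Xx Xy xy]]] := two_symbols X0 sX nfix.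
have [k pX] := Dstar_patchable sX DX.
(* The three points carry [x 0] on the whole lattice, [y 0] on the whole lattice of the next mesh,
   and [x 0] at the origin only. *)
have [xa [Xa xaE]] := lattice_point xpredT clX pX Xx Xy (ltnSn (k 0)).
have [xb [Xb xbE]] := lattice_point xpred0 clX pX Xx Xy (leqW (ltnSn (k 0))).
have [w [Xw wE]] := lattice_point (pred1 0) clX pX Xx Xy (ltnSn (k 0)).
exact: (@marker_code d A X k xa xb w _ _ (k 0).+1 clX pX Xa Xb Xw xy xaE xbE).
Qed.

(** * Spin systems as factors *)

Definition spin := option bool.
HB.instance Definition _ := Finite.on spin.
HB.instance Definition _ := Pointed.on spin.

(* None is an empty site. *)
Definition spin_system (d N b : nat) : set (config d spin) :=
  [set y | let z := y : 'rV[int]_d -> option bool in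
    forall s t, s <> t -> z s -> z t ->
      ~~ nearb N s t && ((z s != z t) ==> ~~ nearb b s t)].

Lemma spin_system_subshift (d N b : nat) : is_subshift (@spin_system d N b).
Proof.
split=> [z clz|t x Yx s s' ss' xs xs']; last first.
  rewrite -(nearb_add N t) -(nearb_add b t); by apply: Yx => // /addIr.
move=> s t st zs zt.
have [y [Yy yz]] := clz _ (nbhs_agree z [:: s; t]).
have [ys yt] : y s = z s /\ y t = z t by split; apply: yz; rewrite !inE eqxx ?orbT.
by rewrite -ys -yt; apply: Yy => //; rewrite ?ys ?yt.
Qed.

(* Deleting all spins that conflict with another one maps any field onto an
   admissible one and fixes the admissible ones. *)
Definition trim (d N b : nat) (z : 'rV[int]_d -> option bool) : config d spin :=
  fun s => if `[< forall t, s <> t -> z t ->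
    ~~ nearb N s t && ((z s != z t) ==> ~~ nearb b s t) >] then z s else None.

Lemma trim_spin_system (d N b : nat) (z : 'rV[int]_d -> option bool) :
  spin_system N b (trim N b z).
Proof.
move=> s t st; rewrite /trim; case: asboolP => // zs; case: asboolP => // zt _.
exact: zs.
Qed.

Lemma trim_id (d N b : nat) (y : config d spin) :
  spin_system N b y -> trim N b y = y.
Proof.
move=> Yy; apply: funext => s; rewrite /trim; case: asboolP => // nys.
by case E : (y s) => [c|//]; case: nys => t st yt; apply: Yy => //; rewrite E.
Qed.

(** The order of quantifiers matters: [N] is fixed by [X] alone and [b] is chosen afterwards. The
    map is onto because an admissible field is separated enough to be coded by markers and is fixed
    by [trim]. Taking [N.+1] keeps the exclusion distance positive. *)
Lemma spin_factor (d : nat) (A : finType) (X : set (config d A)) :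
  (0 < d)%N -> X !=set0 -> is_subshift X -> Dstar_condition X ->
  ~ (exists x : config d A, (forall t, shift_action t x = x) /\ X = [set x]) ->
  exists N : nat, forall b, exists phi : config d A -> config d spin,
    is_factor_map X (@spin_system d N.+1 b) phi.
Proof.
move=> d0 X0 sX DX nfix.
have [N [code [[F HF] Hcode]]] := Dstar_code d0 X0 sX DX nfix; exists N => b.
exists (fun x => trim N.+1 b (fun t => code (shift_action t x))).
split=> //; first exact: spin_system_subshift.
- apply: continuous_subspaceT; apply: finitary_continuous => s.
  have [l Hl] := nearb_seq (maxn N.+1 b) s.
  exists [seq u + t | u <- F, t <- s :: l] => x y xy.
  have cE t : t \in s :: l -> code (shift_action t y) = code (shift_action t x).
    by move=> tl; apply: HF => u uF; apply: xy; apply: allpairs_f.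
  have cs := cE s (mem_head _ _).
  rewrite /trim cs; congr (if _ then _ else _); apply: asbool_equiv_eq.
  have far t : t \notin s :: l -> ~~ nearb N.+1 s t && ~~ nearb b s t.
    rewrite inE negb_or => /andP[_ tl]; apply/andP; split; apply: contra tl => nst;
    apply: Hl; rewrite nearbC; apply: nearb_leq nst; rewrite ?leq_maxl ?leq_maxr//.
  split=> H t st zt.
    have [tl|/far/andP[-> ->]] := boolP (t \in s :: l); last exact: implybT.
    by rewrite -(cE t tl); apply: H; rewrite ?cE.
  have [tl|/far/andP[-> ->]] := boolP (t \in s :: l); last exact: implybT.
  by rewrite (cE t tl); apply: H; rewrite // -cE.
- move=> t x Xx; apply: funext => s; rewrite /trim /shift_action /=.
  have E u : (fun s0 => x (s0 + u + t)) = (fun s0 => x (s0 + (u + t))).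
    by apply: funext => v; rewrite addrA.
  rewrite E; congr (if _ then _ else _); apply: asbool_equiv_eq.
  split=> H u su.
    move=> zu; have := H (u - t); rewrite !E subrK => H'.
    have nE m : nearb m (s + t) u = nearb m s (u - t).
      by rewrite -{1}(subrK t u) nearb_add.
    rewrite !nE; apply: H' => // e.
    by apply: su; rewrite e subrK.
  rewrite !E => zu; have := H (u + t); rewrite !nearb_add; apply => //.
  by move=> /addIr.
- rewrite eqEsubset; split=> [_ [x _ <-]|y Yy]; first exact: trim_spin_system.
  have [s t st ys yt|x [Xx cx]] := Hcode y; first by have /andP[+ _] := Yy s t st ys yt; apply: contra; exact: nearb_leq.
  exists x => //; rewrite -[RHS](trim_id Yy); congr trim; exact: funext.
Qed.

(** * Topological entropy *)

Lemma mem_language (d : nat) (A : finType) (S : {fset 'rV[int]_d})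
    (X : set (config d A)) (w : {ffun S -> A}) :
  (forall t x, X x -> X (shift_action t x)) ->
  reflect (exists x, X x /\ forall s : S, x (val s) = w s) (w \in language S X).
Proof.
move=> Xinv; rewrite inE; apply: (iffP (asboolP _)) => [[x [t [Xx xw]]]|[x [Xx xw]]].
  by exists (shift_action t x); split; [exact: Xinv|move=> s; rewrite -xw].
by exists x, 0; split=> // s; rewrite addr0.
Qed.

(** A pattern is determined by its restrictions to the translates of [S0] that cover [S], and by
    invariance each restriction ranges over the language of [S0]. *)
Lemma card_language_cover (d : nat) (A : finType) (X : set (config d A))
    (S S0 : {fset 'rV[int]_d}) (J : finType) (v : J -> 'rV[int]_d) :
  (forall t x, X x -> X (shift_action t x)) ->
  (forall s, s \in S -> exists j, s - v j \in S0) ->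
  (#|language S X| <= #|language S0 X| ^ #|J|)%N.
Proof.
move=> Xinv cov.
have [X0|nX0] := pselect (X !=set0); last first.
  rewrite (_ : language S X = finset.set0) ?cards0//.
  apply/setP => w; rewrite [RHS]inE; apply/negP => /(mem_language _ Xinv)[x [Xx _]].
  by apply: nX0; exists x.
have /choice[e eP] (w : {ffun S -> A}) : exists x,
    w \in language S X -> X x /\ forall s : S, x (val s) = w s.
  have [/(mem_language _ Xinv)[x ?]|_] := boolP (w \in _); first by exists x.
  by case: X0 => x _; exists x.
pose F w : {ffun J -> {ffun S0 -> A}} :=
  [ffun j => [ffun s : S0 => (e w (val s + v j) : A)]].
rewrite -(card_ffun_on J (mem (language S0 X))) -(card_in_imset (f := F)).
  apply/subset_leq_card/fintype.subsetP => _ /imsetP[w wL ->].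
  apply/ffun_onP => j; rewrite ffunE; apply/(mem_language _ Xinv).
  have [Xe _] := eP w wL; exists (shift_action (v j) (e w)).
  by split=> [|s]; rewrite ?ffunE//; exact: Xinv.
move=> w1 w2 wL1 wL2 F12; apply/ffunP => s.
have [j sj] := cov _ (valP s).
have [_ <-] := eP _ wL1; have [_ <-] := eP _ wL2.
move: F12 => /ffunP/(_ j); rewrite !ffunE => /ffunP/(_ [` sj]%fset).
by rewrite !ffunE /= subrK.
Qed.

Lemma card_language_box (d : nat) (A : finType) (X : set (config d A))
    (n m : 'I_d -> nat) :
  (forall t x, X x -> X (shift_action t x)) -> (forall i, 0 < m i)%N ->
  (#|language (box n) X| <=
     #|language (box m) X| ^ \prod_i (n i %/ m i).+1)%N.
Proof.
move=> Xinv m0.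
pose J := {dffun forall i : 'I_d, 'I_(n i %/ m i).+1}.
have -> : (\prod_i (n i %/ m i).+1)%N = #|{: J}|.
  rewrite card_dep_ffun foldrE big_map big_enum /=.
  by apply: eq_bigr => i _; rewrite card_ord.
apply: (card_language_cover (v := fun j : J => \row_i (m i * j i)%:Z)) => // s.
move=> /mem_box sn.
pose j := [ffun i : 'I_d => inord (absz (s ord0 i - 1)%R %/ m i)] : J.
have jE i : j i = (absz (s ord0 i - 1)%R %/ m i)%N :> nat.
  rewrite ffunE inordK// ltnS leq_div2r//.
  by have := sn i; move: (s ord0 i) => si; lia.
exists j; apply/mem_box => i; rewrite !rwE jE.
have := sn i; move: (s ord0 i) => si si1.
have := divn_eq (absz (si - 1)%R) (m i); have := ltn_pmod (absz (si - 1)%R) (m0 i).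
by lia.
Qed.

Lemma language_gt0 (d : nat) (A : finType) (X : set (config d A))
    (S : {fset 'rV[int]_d}) : X !=set0 -> (0 < #|language S X|)%N.
Proof.
move=> [x Xx]; apply/card_gt0P; exists [ffun s : S => (x (val s) : A)].
by rewrite inE; apply/asboolP; exists x, 0; split=> // s; rewrite addr0 ffunE.
Qed.

Lemma top_entropy_cvg (R : realType) (d : nat) (A : finType)
    (X : set (config d A)) :
  X !=set0 -> (forall t x, X x -> X (shift_action t x)) ->
  (fun n : 'I_d -> nat =>
     (\prod_i (n i)%:R)^-1 * ln (#|language (box n) X|%:R : R)) @ all_to_oo d
  --> top_entropy R X.
Proof.
move=> X0 Xinv; set u := (fun n => _).
pose E := [set u n | n in [set n | forall i, (0 < n i)%N]].
have c1 n : 1 <= #|language (box n) X|%:R :> R.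
  by rewrite ler1n language_gt0.
have lbE : has_lbound E.
  exists 0 => _ [n _ <-]; rewrite mulr_ge0 ?ln_ge0// invr_ge0.
  by apply: prodr_ge0 => i _; rewrite ler0n.
have infE : has_inf E by split=> //; exists (u (fun=> 1%N)), (fun=> 1%N).
(* Subadditivity (Fekete): the limit is the infimum over boxes. *)
suff H : u @ all_to_oo d --> inf E.
  by rewrite /top_entropy -/u (cvg_lim (@Rhausdorff R) H).
apply/cvgrPdist_lt => e e0.
have [_ [m m0 <-] um] := inf_adherent e0 infE.
(* For [n i >= N + 1] one has [(n i %/ m i + 1) / n i <= 1 / m i + 1 / (N + 1)], so subadditivity
   gives [u n <= g N], while [g] tends to [u m]. *)
pose g (N : nat) := ln (#|language (box m) X|%:R : R) *
  \prod_i ((m i)%:R^-1 + N.+1%:R^-1).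
have g_cvg : g @ \oo --> u m.
  rewrite /u mulrC -prodfV; apply: cvgM; first exact: cvg_cst.
  apply: (cvg_big (@mul_continuous R)) => i _.
  rewrite -[X in _ --> X]addr0; apply: cvgD; first exact: cvg_cst.
  exact: cvg_harmonic.
have [N _ gN] := cvgr_lt _ g_cvg _ um.
exists N.+1 => // n nN /=.
have n0 i : (0 < n i)%N by apply: leq_trans (nN i).
have uE : inf E <= u n by apply: ge_inf => //; exists n.
rewrite distrC ger0_norm ?subr_ge0// ltrBlDl; apply: le_lt_trans (gN N _) => //=.
have pn0 : 0 < \prod_i (n i)%:R :> R by apply: prodr_gt0 => i _; rewrite ltr0n.
rewrite /u mulrC ler_pdivrMr//.
have le1 : ln #|language (box n) X|%:R <=
    ln (#|language (box m) X|%:R : R) *+ \prod_i (n i %/ m i).+1.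
  rewrite -lnXn ?ltr0n ?language_gt0// -natrX ler_ln ?posrE ?ltr0n ?expn_gt0 ?language_gt0//.
  by rewrite ler_nat card_language_box.
apply: le_trans le1 _; rewrite -[_ *+ _]mulr_natr natr_prod /g -mulrA -big_split /=.
apply: ler_wpM2l; first exact: ln_ge0.
apply: ler_prod => i _; rewrite ler0n /= mulrDl -(@natr1 R).
have mi : 0 < (m i)%:R :> R by rewrite ltr0n.
apply: lerD.
  rewrite mulrC ler_pdivlMr// -natrM ler_nat; exact: leq_divM.
by rewrite mulrC ler_pdivlMr ?ltr0n// mul1r ler_nat.
Qed.

Lemma top_entropy_cvg_cube (R : realType) (d : nat) (A : finType)
    (X : set (config d A)) :
  X !=set0 -> (forall t x, X x -> X (shift_action t x)) ->
  (fun N : nat => (N%:R ^+ d)^-1 *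
     ln (#|language (box (fun _ : 'I_d => N)) X|%:R : R)) @ \oo
  --> top_entropy R X.
Proof.
move=> X0 Xinv; have H := top_entropy_cvg (R := R) X0 Xinv.
pose q (N : nat) := fun _ : 'I_d => N.
have qF : q @ \oo --> all_to_oo d.
  by move=> B [N _ NB]; exists N => // M NM; apply: NB => i.
have := cvg_comp q _ qF H.
rewrite (_ : _ \o q = fun N : nat => (N%:R ^+ d)^-1 *
     ln (#|language (box (fun _ : 'I_d => N)) X|%:R : R))//.
by apply: funext => N; rewrite /= /q prodr_const card_ord.
Qed.

Definition spin_ok (N b d : nat) (S : {fset 'rV[int]_d}) (w : {ffun S -> spin}) :=
  [forall s : S, forall t : S, [&& s != t, isSome (w s) & isSome (w t)] ==>
    (~~ nearb N (val s) (val t) &&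
      ((w s != w t) ==> ~~ nearb b (val s) (val t)))].

Lemma spin_okP (N b d : nat) (S : {fset 'rV[int]_d}) (w : {ffun S -> spin}) :
  reflect (forall s t : S, s != t -> w s -> w t ->
    ~~ nearb N (val s) (val t) && ((w s != w t) ==> ~~ nearb b (val s) (val t)))
  (spin_ok N b w).
Proof.
apply: (iffP forallP) => [H s t st ws wt|H s].
  by have /forallP/(_ t)/implyP := H s; apply; apply/and3P.
by apply/forallP => t; apply/implyP => /and3P[]; exact: H.
Qed.

Definition extend_none (d : nat) (S : {fset 'rV[int]_d}) (w : {ffun S -> spin}) :
    config d spin := fun s => if insub s is Some t then w t else None.

Lemma extend_noneE (d : nat) (S : {fset 'rV[int]_d}) (w : {ffun S -> spin}) (s : S) :
  extend_none w (val s) = w s.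
Proof. by rewrite /extend_none valK. Qed.

(** Empty sites impose no constraint, so a locally admissible pattern extends by empty sites to a
    point of the system. *)
Lemma language_spin (d N b : nat) (S : {fset 'rV[int]_d}) (w : {ffun S -> spin}) :
  (w \in language S (@spin_system d N b)) = spin_ok N b w.
Proof.
have Yinv := (spin_system_subshift d N b).2.
apply/(mem_language _ Yinv)/spin_okP => [[y [Yy yw]] s t st ws wt|H].
  rewrite -!yw; apply: Yy; rewrite ?yw//.
  by move/val_inj => e; rewrite e eqxx in st.
exists (extend_none w); split; last exact: extend_noneE.
move=> s t st; rewrite /extend_none.
case: insubP => // s' _ es; case: insubP => // t' _ et ws wt.
by rewrite -es -et H//; apply/eqP => e; apply: st; rewrite -es -et e.
Qed.

(** All spins placed are +, so only the distance [N.+1] constrains them: on a lattice of that mesh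
    each site is occupied or not at will. *)
Lemma card_language_spin_ge (d N b M : nat) :
  (2 ^ (M ^ d) <= #|language (box (fun _ : 'I_d => M * N.+1)%N)
                     (@spin_system d N.+1 b)|)%N.
Proof.
pose J := {ffun 'I_d -> 'I_M}.
pose S := box (fun _ : 'I_d => M * N.+1)%N.
pose v (j : J) : 'rV[int]_d := \row_i (1 + (N.+1 * j i)%N%:Z).
have vS j : v j \in S.
  apply/mem_box => i; rewrite rwE; have := ltn_ord (j i).
  by move: (j i : nat) => ji; nia.
have v_near j j' : j != j' -> ~~ nearb N.+1 (v j) (v j').
  move=> jj'; apply/negP => /forallP H; case/eqP: jj'; apply/ffunP => i.
  apply/val_inj; have := H i; rewrite !rwE /=.
  by move: (j i : nat) (j' i : nat) => a a'; nia.
pose F (f : {ffun J -> bool}) : {ffun S -> spin} :=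
  [ffun s : S => if [exists j, f j && (val s == v j)] then Some true else None].
have FE f j : F f [` vS j]%fset = if f j then Some true else None.
  rewrite ffunE /=; congr (if _ then _ else _); apply/existsP/idP => [[j' /andP[fj']]|fj].
    have [->//|jj'] := eqVneq j j'; move/eqP => e; have := v_near _ _ jj'.
    by rewrite e nearb_refl.
  by exists j; rewrite fj eqxx.
rewrite -[(M ^ d)%N](_ : #|{: J}| = _); last by rewrite card_ffun !card_ord.
rewrite -[X in (X ^ _)%N]card_bool -card_ffun -(card_imset _ (f := F)).
  apply/subset_leq_card/fintype.subsetP => _ /imsetP[f _ ->].
  rewrite language_spin; apply/spin_okP => s t st; rewrite !ffunE.
  case: ifP => // /existsP[j /andP[_ /eqP es]] _.
  case: ifP => // /existsP[j' /andP[_ /eqP et]] _; rewrite eqxx andbT es et.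
  apply: v_near; apply: contra st => /eqP e; apply/eqP/val_inj.
  by rewrite es et e.
move=> f f' /ffunP ff'; apply/ffunP => j; have := ff' [` vS j]%fset; rewrite !FE.
by case: (f j); case: (f' j).
Qed.

Lemma spin_system_nonempty (d N b : nat) : @spin_system d N b !=set0.
Proof. by exists (fun=> None). Qed.

Lemma top_entropy_spin_gt0 (R : realType) (d N b : nat) :
  0 < top_entropy R (@spin_system d N.+1 b).
Proof.
have H := top_entropy_cvg_cube (R := R) (spin_system_nonempty d N.+1 b)
  (spin_system_subshift d N.+1 b).2.
have ln2 : 0 < ln (2 : R) by rewrite ln_gt0// ltr1n.
apply: (@lt_le_trans _ _ (ln 2 / N.+1%:R ^+ d)).
  by rewrite divr_gt0// exprn_gt0// ltr0n.
pose q M := (M.+1 * N.+1)%N.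
have qF : q @ \oo --> \oo.
  by move=> B [n _ nB]; exists n => // M nM; apply: nB; rewrite /= /q; move: nM => /=; nia.
apply: (ler_cvg_to (cvg_cst _) (cvg_comp q _ qF H)).
apply: nearW => M /=; rewrite /q.
have M0 : 0 < M.+1%:R ^+ d :> R by rewrite exprn_gt0// ltr0n.
have N0 : 0 < N.+1%:R ^+ d :> R by rewrite exprn_gt0// ltr0n.
rewrite ler_pdivlMl; last by rewrite exprn_gt0// ltr0n muln_gt0.
rewrite natrM exprMn mulrACA mulrA mulfK ?gt_eqF// mulrC -natrX mulr_natr.
rewrite -lnXn ?ltr0n// ler_ln ?posrE ?exprn_gt0 ?ltr0n//; last first.
  by apply: language_gt0; exact: spin_system_nonempty.
by rewrite -natrX ler_nat card_language_spin_ge.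
Qed.

(** * Healing of empty cubes *)

Definition in_cube (d c : nat) (v s : 'rV[int]_d) : bool :=
  [forall i, v ord0 i <= s ord0 i < v ord0 i + c%:Z].

Lemma in_cube_disjoint (d c : nat) (v v' s : 'rV[int]_d) :
  in_cube c v s -> in_cube c v' s -> nearb c v v'.
Proof.
move=> /forallP vs /forallP v's; apply/forallP => i.
by have := vs i; have := v's i; lia.
Qed.

Definition empty_cube (d c : nat) (S : {fset 'rV[int]_d}) (w : {ffun S -> spin})
    (v : 'rV[int]_d) : bool :=
  [forall s : S, in_cube c v (val s) ==> ~~ isSome (w s)].

Definition vacant (d c N b : nat) (S : {fset 'rV[int]_d}) (G : seq 'rV[int]_d) :=
  [set w : {ffun S -> spin} | spin_ok N b w && all (empty_cube c w) G]%SET.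

Section Healing.
Variables (d N q : nat) (S : {fset 'rV[int]_d}).
(* A cube of side c contains q diagonal sites at distance at least N from its
   complement. *)
Let c := (N + N + q)%N.
Let b := (c + c)%N.
Variables (v : 'rV[int]_d) (G : seq 'rV[int]_d).
Hypothesis d0 : (0 < d)%N.
Hypothesis vS : forall s, in_cube c v s -> s \in S.
Hypothesis vG : forall v', v' \in G -> ~~ nearb c v v'.

Implicit Types w : {ffun S -> spin}.

Let site (k : 'I_q) : 'rV[int]_d := \row_i (v ord0 i + (N + k)%N%:Z).

Let site_in_cube k : in_cube c v (site k).
Proof.
apply/forallP => i; rewrite !rwE /c; have := ltn_ord k.
by move: (v ord0 i) (k : nat) => vi ki; lia.
Qed.

Let p (k : 'I_q) : S := [` vS (site_in_cube k)]%fset.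

Let far_outside k s : ~~ in_cube c v s -> ~~ nearb N (site k) s.
Proof.
apply: contra => /forallP ns; apply/forallP => i; have := ns i; rewrite !rwE /c.
by have := ltn_ord k; move: (v ord0 i) (k : nat) => vi ki; lia.
Qed.

(** The connected components of this relation are the clusters. Admissibility makes the sign
    constant on a cluster, and changing the sign of a whole cluster preserves admissibility. *)
Let link w : rel S := [rel s t | [&& isSome (w s), isSome (w t)
  & nearb b (val s) (val t)]].

Let reached w k (s : S) := isSome (w s) && [exists t : S,
  [&& nearb b (val t) (site k), isSome (w t) & connect (link w) t s]].

Let heal w k : {ffun S -> spin} :=
  [ffun s => if (s == p k) || reached w k s then Some true else w s].

(* Spins of one orthant around the site that are close to it are close to each
   other, hence equal: signs records enough to undo heal. *)
Let orthant (t : 'rV[int]_d) k : {ffun 'I_d -> bool} :=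
  [ffun i => site k ord0 i <= t ord0 i].

Let signs w k : {ffun {ffun 'I_d -> bool} -> bool} :=
  [ffun o => [exists t : S, [&& nearb b (val t) (site k), w t == Some false
     & orthant (val t) k == o]]].

Let link_eq w s t : spin_ok N b w -> link w s t -> w s = w t.
Proof.
move=> /spin_okP ok /and3P[ws wt nst]; have [->//|st] := eqVneq s t.
by have /andP[_] := ok s t st ws wt; rewrite nst implybF negbK => /eqP.
Qed.

Let connect_eq w s t : spin_ok N b w -> connect (link w) s t -> w s = w t.
Proof.
move=> ok /connectP[l + ->]; elim: l s => //= u l IH s /andP[su ul].
by rewrite (link_eq ok su) (IH _ ul).
Qed.

Let orthant_near k (s t : 'rV[int]_d) : nearb b s (site k) -> nearb b t (site k) ->
  orthant s k = orthant t k -> nearb b s t.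
Proof.
move=> /forallP sk /forallP tk /ffunP o; apply/forallP => i.
have := sk i; have := tk i; have := o i; rewrite !ffunE.
by move: (site k ord0 i) (s ord0 i) (t ord0 i) => x y z; lia.
Qed.

Let empty_in w s : empty_cube c w v -> in_cube c v (val s) -> w s = None.
Proof. by move=> /forallP/(_ s)/implyP H /H; case: (w s). Qed.

(** All old spins lie outside the cube, hence at distance at least [N] from the new one; those
    closer than [b] belong to reached clusters and have become +. The cubes of [G] stay empty
    because they are disjoint from the one at [v]. *)
Let heal_vacant w k : w \in vacant c N b S (v :: G) -> heal w k \in vacant c N b S G.
Proof.
rewrite !inE /= => /and3P[ok ev eG].
have wp : w (p k) = None by exact: (@empty_in w (p k) ev (site_in_cube k)).
have Nfar s : isSome (w s) -> ~~ nearb N (site k) (val s).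
  by move=> ws; apply: far_outside; apply/negP => /(empty_in ev) e; rewrite e in ws.
have healS s : isSome (heal w k s) = (s == p k) || isSome (w s).
  by rewrite ffunE; case: eqP => //= _; rewrite /reached; case: (w s) => //= e; case: ifP.
apply/andP; split.
  apply/spin_okP => s t st; rewrite !healS => hs ht; apply/andP; split.
    have [es|sp] := eqVneq s (p k).
      by rewrite es; apply: Nfar; move: ht; rewrite -es eq_sym (negPf st).
    have [et|tp] := eqVneq t (p k).
      by rewrite et nearbC; apply: Nfar; move: hs; rewrite (negPf sp).
    move: hs ht; rewrite (negPf sp) (negPf tp) => ws wt.
    by have /spin_okP/(_ s t st ws wt)/andP[] := ok.
  apply/implyP; apply: contra => nst; apply/eqP; rewrite !ffunE.
  have near_p r : isSome (w r) -> nearb b (val r) (site k) -> reached w k r.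
    by move=> wr nr; rewrite /reached wr; apply/existsP; exists r; rewrite nr wr connect0.
  have [es|sp] /= := eqVneq s (p k).
    rewrite near_p ?orbT//; last by rewrite nearbC -[site k]/(val (p k)) -es.
    by move: ht; rewrite -es eq_sym (negPf st).
  have [et|tp] /= := eqVneq t (p k).
    rewrite near_p ?orbT//; last by rewrite -[site k]/(val (p k)) -et.
    by move: hs; rewrite (negPf sp).
  move: hs ht; rewrite (negPf sp) (negPf tp) /= => ws wt.
  have lst : link w s t by apply/and3P.
  have lts : link w t s by apply/and3P; rewrite nearbC.
  rewrite (link_eq ok lst) /reached ws wt /=; congr (if _ then _ else _).
  apply: eq_existsb => r; congr [&& _, _ & _].
  apply/idP/idP => /connect_trans; apply; exact: connect1.
apply/allP => v' v'G; apply/forallP => s; apply/implyP => sv'.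
have /forallP/(_ s)/implyP/(_ sv') ws := allP eG v' v'G.
rewrite healS (negPf ws) orbF; apply/eqP => es.
have := vG v'G; rewrite (in_cube_disjoint _ sv')// es; exact: site_in_cube.
Qed.

(** The cube was empty, so [k] is the index of its only diagonal site occupied afterwards. The
    occupied sites, hence the clusters, are then known; only the old signs of the reached clusters
    are lost, and each of these has a spin near the site, whose sign is read off [signs] at its
    orthant. *)
Let heal_inj (x y : {ffun S -> spin} * 'I_q) :
  x.1 \in vacant c N b S (v :: G) -> y.1 \in vacant c N b S (v :: G) ->
  heal x.1 x.2 = heal y.1 y.2 -> signs x.1 x.2 = signs y.1 y.2 -> x = y.
Proof.
case: x y => [w k] [w' k'] /=; rewrite !inE /= => /and3P[ok ev _] /and3P[ok' ev' _] hh ss.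
have wp l : w (p l) = None by exact: (@empty_in w (p l) ev (site_in_cube l)).
have wp' l : w' (p l) = None by exact: (@empty_in w' (p l) ev' (site_in_cube l)).
have ekk : k = k'.
  have := congr1 (fun f : {ffun S -> spin} => f (p k)) hh.
  rewrite !ffunE eqxx /= wp' /reached wp' /= orbF; case: eqP => // /(congr1 val) /= e _.
  have := congr1 (fun s : 'rV[int]_d => s ord0 (Ordinal d0)) e.
  by rewrite !rowE => /addrI [] /addnI /val_inj.
move: hh ss; rewrite -ekk => hh ss; congr (_, _); apply/ffunP => s.
have supp t : isSome (w t) = isSome (w' t).
  have := congr1 (fun f : {ffun S -> spin} => isSome (f t)) hh; rewrite !ffunE.
  have [->|_] /= := eqVneq t (p k); first by rewrite wp wp'.
  by rewrite /reached; case: (w t) => [?|]; case: (w' t) => [?|] //=; do ?case: ifP.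
have elink : link w =2 link w' by move=> t u; rewrite /link /= !supp.
have ereach : reached w k s = reached w' k s.
  rewrite /reached supp; congr andb; apply: eq_existsb => t.
  by rewrite supp (eq_connect elink).
have [->|sp] := eqVneq s (p k); first by rewrite wp wp'.
have [/andP[ws /existsP[t /and3P[nt wt ct]]]|nr] := boolP (reached w k s); last first.
  have := congr1 (fun f : {ffun S -> spin} => f s) hh.
  by rewrite !ffunE (negPf sp) -ereach (negPf nr).
have ct' : connect (link w') t s by rewrite -(eq_connect elink).
rewrite -(connect_eq ok ct) -(connect_eq ok' ct').
have key u : spin_ok N b u -> isSome (u t) ->
    (u t == Some false) = signs u k (orthant (val t) k).
  move=> oku ut; rewrite ffunE; apply/idP/existsP => [utf|[r /and3P[nr ur /eqP er]]].
    by exists t; rewrite nt utf eqxx.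
  rewrite -(eqP ur) eq_sym; apply/eqP; apply: link_eq oku _.
  by apply/and3P; split; rewrite ?(eqP ur)//; apply: orthant_near er.
have := key w ok wt; rewrite ss -(key w' ok') -?supp//.
by move: wt (wt); rewrite {2}supp; case: (w t) => [[]|] //; case: (w' t) => [[]|].
Qed.

Lemma card_vacant_heal :
  (#|vacant c N b S (v :: G)| * q <= 2 ^ (2 ^ d) * #|vacant c N b S G|)%N.
Proof.
pose F (x : {ffun S -> spin} * 'I_q) := (heal x.1 x.2, signs x.1 x.2).
have <- : #|finset.setX (vacant c N b S (v :: G)) [set: 'I_q]%SET| =
    (#|vacant c N b S (v :: G)| * q)%N by rewrite cardsX cardsT card_ord.
have <- : #|finset.setX (vacant c N b S G) [set: {ffun {ffun 'I_d -> bool} -> bool}]%SET| =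
    (2 ^ (2 ^ d) * #|vacant c N b S G|)%N.
  by rewrite cardsX cardsT !card_ffun !card_bool card_ord mulnC.
rewrite -(card_in_imset (f := F)).
  apply/subset_leq_card/fintype.subsetP => _ /imsetP[[w k] /finset.setXP[/= wv _] ->].
  by apply/finset.setXP; split; [exact: heal_vacant|rewrite finset.in_setT].
by move=> [w k] [w' k'] /finset.setXP[wv _] /finset.setXP[w'v _] [hh ss]; exact: heal_inj.
Qed.
End Healing.

(** * Empty cubes under a measure of maximal entropy *)

(** This is [ln x <= x - 1] at [x = f i / (Z * p i)], averaged over [p]: the finite variational
    principle, with [f] an unnormalised weight. *)
Lemma gibbs_inequality (R : realType) (I : finType) (A : {set I}) (p f : I -> R) :
  (forall i, 0 <= p i) -> \sum_(i in A) p i = 1 -> (forall i, 0 < f i) ->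
  \sum_(i in A) - (p i * ln (p i)) <=
    ln (\sum_(i in A) f i) - \sum_(i in A) p i * ln (f i).
Proof.
move=> p0 p1 f0; set Z := \sum_(i in A) f i.
have Z0 : 0 < Z.
  have [i iA] : exists i, i \in A.
    apply/set0Pn; apply/eqP => A0; move: p1; rewrite A0 big_set0 => /esym/eqP.
    by rewrite oner_eq0.
  rewrite /Z (bigD1 i)//= ltr_pwDl//; apply: sumr_ge0 => j _; exact: ltW.
rewrite -subr_le0 opprB addrA -[X in _ - X]mul1r -p1 mulr_suml -big_split -sumrB /=.
apply: (@le_trans _ _ (\sum_(i in A) (f i / Z - p i))); last first.
  by rewrite sumrB p1 -mulr_suml divff ?gt_eqF// subrr.
apply: ler_sum => i iA.
have [pi0|pi0] := eqVneq (p i) 0.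
  by rewrite pi0 !mul0r; have := divr_ge0 (ltW (f0 i)) (ltW Z0); lra.
have {}pi0 : 0 < p i by rewrite lt_neqAle eq_sym pi0 p0.
have x0 : 0 < f i / Z / p i by rewrite !divr_gt0.
have : p i * ln (f i / Z / p i) <= p i * (f i / Z / p i - 1).
  rewrite ler_pM2l//; have := @le_ln1Dx R (f i / Z / p i - 1).
  by rewrite addrCA subrr addr0; apply; lra.
have e : p i * (f i / Z / p i) = f i / Z by rewrite mulrC divfK ?gt_eqF.
rewrite mulrBr e mulr1 !ln_div ?posrE ?divr_gt0//.
by move: (ln _) (ln _) (ln _) => x y z; lra.
Qed.

Lemma pairwise_catCA (T : Type) (r : rel T) (s1 s2 s3 : seq T) : symmetric r ->
  pairwise r (s1 ++ s2 ++ s3) = pairwise r (s2 ++ s1 ++ s3).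
Proof.
move=> rsym; rewrite !pairwise_cat !allrel_catr.
have -> : allrel r s2 s1 = allrel r s1 s2.
  by rewrite allrelC; apply: eq_allrel => x y; rewrite rsym.
by case: allrel; case: allrel; case: allrel; case: pairwise; case: pairwise.
Qed.

Section Weights.
Variables (R : realType) (d N q : nat) (S : {fset 'rV[int]_d}).
Let c := (N + N + q)%N.
Let b := (c + c)%N.
Let kappa : R := (2 ^ (2 ^ d))%:R / q%:R.
Hypothesis d0 : (0 < d)%N.
Hypothesis q0 : (0 < q)%N.

Let kappa0 : 0 <= kappa. Proof. by rewrite divr_ge0. Qed.

Definition inside (G : seq 'rV[int]_d) :=
  forall v s, v \in G -> in_cube c v s -> s \in S.

Lemma inside_sub (G G' : seq 'rV[int]_d) :
  {subset G' <= G} -> inside G -> inside G'.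
Proof. by move=> sub inS v s /sub; exact: inS. Qed.

Lemma card_vacant_le (G : seq 'rV[int]_d) :
  pairwise (fun v v' => ~~ nearb c v v') G -> inside G ->
  #|vacant c N b S G|%:R <= kappa ^+ size G * #|vacant c N b S [::]|%:R :> R.
Proof.
elim: G => [|v G IH] /=; first by rewrite expr0 mul1r.
move=> /andP[/allP vG farG] inS.
have {}IH := IH farG (inside_sub (mem_behead (s := v :: G)) inS).
have heal := card_vacant_heal d0 (inS v ^~ (mem_head v G)) vG.
rewrite exprS -mulrA; apply: le_trans (ler_wpM2l kappa0 IH).
rewrite /kappa mulrAC ler_pdivlMr ?ltr0n// -!natrM ler_nat.
exact: heal.
Qed.

(* The weight to which Gibbs' inequality is applied: a factor 2 for every block of
   cubes that is empty. *)
Let bonus (w : {ffun S -> spin}) (Ts : seq (seq 'rV[int]_d)) : R :=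
  \prod_(T <- Ts) (1 + (all (empty_cube c w) T)%:R).

(** Expanding one factor [1 + [T is empty]] leaves two sums: one over the same patterns, and one in
    which the [g] cubes of [T] join [C] and cost [kappa ^+ g]. This is why the induction carries an
    arbitrary [C]. *)
Lemma vacant_weight (g : nat) (Ts : seq (seq 'rV[int]_d)) (C : seq 'rV[int]_d) :
  all (fun T => size T == g) Ts ->
  pairwise (fun v v' => ~~ nearb c v v') (flatten Ts ++ C) ->
  inside (flatten Ts ++ C) ->
  \sum_(w in vacant c N b S C) bonus w Ts <=
    kappa ^+ size C * (1 + kappa ^+ g) ^+ size Ts * #|vacant c N b S [::]|%:R.
Proof.
elim: Ts C => [|T Ts IH] C /=.
  move=> _ far inS; rewrite expr0 mulr1.
  under eq_bigr do rewrite /bonus big_nil.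
  by rewrite sumr_const; exact: card_vacant_le.
move=> /andP[/eqP sT sTs] far inS.
have farC : pairwise (fun v v' => ~~ nearb c v v') (flatten Ts ++ C).
  by move: far; rewrite -catA pairwise_cat => /and3P[].
have permTC : perm_eq ((T ++ flatten Ts) ++ C) (flatten Ts ++ T ++ C).
  by rewrite -catA perm_catCA.
have far' : pairwise (fun v v' => ~~ nearb c v v') (flatten Ts ++ T ++ C).
  by rewrite pairwise_catCA ?catA// => v v'; rewrite nearbC.
have inT1 : {subset flatten Ts ++ C <= (T ++ flatten Ts) ++ C}.
  by move=> v; rewrite -catA [in X in _ -> X]mem_cat => ->; rewrite orbT.
have inT2 : {subset flatten Ts ++ T ++ C <= (T ++ flatten Ts) ++ C}.
  by move=> v; rewrite (perm_mem permTC).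
have IH1 := IH C sTs farC (inside_sub inT1 inS).
have IH2 := IH (T ++ C) sTs far'
  (inside_sub inT2 inS).
have -> : \sum_(w in vacant c N b S C) bonus w (T :: Ts) =
    \sum_(w in vacant c N b S C) bonus w Ts +
    \sum_(w in vacant c N b S (T ++ C)) bonus w Ts.
  rewrite [X in _ + X](_ : _ = \sum_(w in vacant c N b S C)
      (all (empty_cube c w) T)%:R * bonus w Ts).
    rewrite -big_split; apply: eq_bigr => w _ /=.
    by rewrite /bonus big_cons mulrDl mul1r.
  rewrite big_mkcond [RHS]big_mkcond; apply: eq_bigr => w _.
  rewrite !inE all_cat; case: (spin_ok N b w) => //=.
  by case: all => /=; case: all => //=; rewrite ?mul1r ?mul0r.
rewrite exprS mulrDl mul1r mulrDr mulrDl; apply: lerD; first exact: IH1.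
by apply: le_trans IH2 _; rewrite size_cat sT exprD [kappa ^+ g * _]mulrC !mulrA.
Qed.
End Weights.

(** * Measurability of local events and real-valued probabilities *)

Lemma open_measurable_config (d : nat) (A : finPointedType)
    (E : set (config d A)) : open E -> measurable (E : set (borel_config d A)).
Proof. by move=> oE; apply: sub_sigma_algebra. Qed.

Lemma finitary_measurable (d : nat) (A : finPointedType)
    (E : set (config d A)) : finitary E -> measurable (E : set (borel_config d A)).
Proof. by move=> /finitary_open/open_measurable_config. Qed.

Lemma closed_measurable_config (d : nat) (A : finPointedType)
    (E : set (config d A)) : closed E -> measurable (E : set (borel_config d A)).
Proof.
move=> cE; rewrite -[E]setCK; apply: measurableC.
by apply: open_measurable_config; exact: closed_openC.
Qed.

Section RealProbability.
Variables (R : realType) (disp : measure_display) (T : measurableType disp).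
Variable mu : probability T R.
Implicit Types E F : set T.

Definition pr E : R := fine (mu E).

Lemma pr_ge0 E : 0 <= pr E.
Proof. exact: fine_ge0. Qed.

Lemma pr_setU E F : measurable E -> measurable F -> E `&` F = set0 ->
  pr (E `|` F) = pr E + pr F.
Proof.
move=> mE mF EF0; rewrite {1}/pr measureU//.
by rewrite fineD ?fin_num_measure.
Qed.

Lemma pr_le E F : measurable E -> measurable F -> E `<=` F -> pr E <= pr F.
Proof.
move=> mE mF EF; rewrite /pr fine_le ?fin_num_measure//.
by rewrite le_measure ?inE.
Qed.

Lemma pr_setT : pr setT = 1.
Proof. by rewrite /pr probability_setT. Qed.

Lemma pr_set0 : pr set0 = 0.
Proof. by rewrite /pr measure0. Qed.

Lemma pr_le1 E : measurable E -> pr E <= 1.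
Proof. by move=> mE; rewrite -pr_setT; apply: pr_le. Qed.

Lemma pr_setI_setC E F : measurable E -> measurable F ->
  pr E = pr (E `&` F) + pr (E `&` ~` F).
Proof.
move=> mE mF; rewrite -pr_setU.
- by rewrite -setIUr setUv setIT.
- exact: measurableI.
- by apply: measurableI => //; exact: measurableC.
- by rewrite setIACA setICr setI0.
Qed.

Lemma pr_setIl E F : measurable E -> measurable F -> pr (E `&` F) <= pr E.
Proof. by move=> mE mF; apply: pr_le => //; exact: measurableI. Qed.

Lemma pr_setI_full E F : measurable E -> measurable F -> pr F = 1 ->
  pr E = pr (E `&` F).
Proof.
move=> mE mF F1; rewrite (pr_setI_setC mE mF).
suff -> : pr (E `&` ~` F) = 0 by rewrite addr0.
have mFC := measurableC mF.
apply/le_anti/andP; split; last exact: pr_ge0.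
have <- : pr (~` F) = 0.
  have := pr_setI_setC (measurableT : measurable [set: T]) mF.
  by rewrite !setTI pr_setT F1; lra.
by rewrite setIC; exact: pr_setIl.
Qed.

Lemma pr_setU_le E F : measurable E -> measurable F ->
  pr (E `|` F) <= pr E + pr F.
Proof.
move=> mE mF; rewrite (pr_setI_setC (F := E) (measurableU _ _ mE mF) mE).
have mEC := measurableC mE; have mU := measurableU _ _ mE mF.
apply: lerD.
  by apply: (pr_le (measurableI _ _ mU mE) mE) => x [].
by apply: (pr_le (measurableI _ _ mU mEC) mF) => x [[]].
Qed.

Lemma pr_cover (I : eqType) (r : seq I) E (F : I -> set T) : measurable E ->
  (forall i, measurable (F i)) ->
  (forall x, E x -> exists2 i, i \in r & F i x) ->
  pr E <= \sum_(i <- r) pr (F i).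
Proof.
elim: r E => [|i r IH] E mE mF cov.
  by rewrite big_nil (_ : E = set0) ?pr_set0// -subset0 => x /cov[].
rewrite big_cons (pr_setI_setC mE (mF i)); apply: lerD.
  by apply: (pr_le (measurableI _ _ mE (mF i)) (mF i)) => x [].
apply: IH => //; first by apply: measurableI => //; exact: measurableC.
move=> x [Ex nFx]; have [j] := cov x Ex; rewrite inE => /predU1P[->//|jr Fj].
by exists j.
Qed.
End RealProbability.

Definition restr (d : nat) (A : finType) (S : {fset 'rV[int]_d})
  (x : config d A) : {ffun S -> A} := [ffun s : S => (x (val s) : A)].

Lemma restr_finitary (d : nat) (A : finType) (S : {fset 'rV[int]_d})
    (Q : {ffun S -> A} -> Prop) : finitary [set x : config d A | Q (restr S x)].
Proof.
exists (enum_fset S) => x y xy /=; rewrite (_ : restr S y = restr S x)//.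
by apply/ffunP => s; rewrite !ffunE; apply: xy; exact: valP.
Qed.

Lemma cylinderE (d : nat) (A : finType) (S : {fset 'rV[int]_d})
    (w : {ffun S -> A}) : cylinder w = [set x : config d A | restr S x = w].
Proof.
rewrite eqEsubset; split=> x /=; first by move=> xw; apply/ffunP => s; rewrite ffunE xw.
by move=> <- s; rewrite ffunE.
Qed.

Lemma cylinder_measurable (d : nat) (A : finPointedType) (S : {fset 'rV[int]_d})
    (w : {ffun S -> A}) : measurable (cylinder w : set (borel_config d A)).
Proof.
by rewrite cylinderE; apply: finitary_measurable; exact: (restr_finitary (fun u => u = w)).
Qed.

(** Cylinders of patterns outside the language miss [X] and are null, so sums over the language, as
    in the definition of entropy, lose no mass. *)
Lemma pr_restr (R : realType) (d : nat) (A : finPointedType)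
    (X : set (config d A)) (mu : probability (borel_config d A) R)
    (S : {fset 'rV[int]_d}) (Q : pred {ffun S -> A}) :
  closed X -> mu X = 1%E ->
  pr mu [set x | Q (restr S x)] =
    \sum_(w in language S X | Q w) pr mu (cylinder w).
Proof.
move=> clX muX.
have mX := closed_measurable_config clX.
have mQ (P : {ffun S -> A} -> Prop) : measurable ([set x | P (restr S x)] : set (borel_config d A)).
  by apply: finitary_measurable; exact: restr_finitary.
have XC0 : pr mu (~` X) = 0.
  have := pr_setI_setC mu (measurableT : measurable [set: borel_config d A]) mX.
  by rewrite !setTI pr_setT {1}/pr muX /=; lra.
have H r : uniq r -> pr mu [set x | restr S x \in r] = \sum_(w <- r) pr mu (cylinder w).
  elim: r => [_|w r IH /= /andP[wr ur]].
    by rewrite big_nil (_ : [set x | _] = set0) ?pr_set0// -subset0.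
  rewrite big_cons -IH// -pr_setU.
  - congr (pr mu _); rewrite cylinderE eqEsubset; split=> x /=.
      by rewrite inE => /predU1P.
    by rewrite inE => /predU1P.
  - exact: cylinder_measurable.
  - exact: (mQ (fun u => u \in r)).
  - rewrite -subset0 cylinderE => x /= [-> wr']; by rewrite wr' in wr.
rewrite (_ : [set x | Q (restr S x)] = [set x | restr S x \in enum Q]); last first.
  by apply/seteqP; split=> x /=; rewrite mem_enum.
rewrite H ?enum_uniq// big_enum /= [RHS](eq_bigl (fun w => (w \in Q) && (w \in language S X))); last first.
  by move=> w; rewrite andbC.
rewrite [RHS]big_mkcondr /=; apply: eq_bigr => w _; case: ifPn => // wL.
apply/le_anti/andP; split; last exact: pr_ge0.
rewrite -XC0; apply: pr_le.
- exact: cylinder_measurable.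
- exact: measurableC.
- move=> x xw Xx; move/negP: wL; apply; rewrite inE; apply/asboolP.
  by exists x, 0; split=> // s; rewrite addr0 xw.
Qed.

(* lim is 0 on a divergent sequence, so a positive value forces convergence. *)
Lemma measure_entropy_cvg (R : realType) (d : nat) (A : finPointedType)
    (X : set (config d A)) (mu : probability (borel_config d A) R) :
  0 < measure_entropy X mu ->
  (fun N : nat => (N%:R ^+ d)^-1 *
     \sum_(w in language (box (fun _ : 'I_d => N)) X)
       - (pr mu (cylinder w) * ln (pr mu (cylinder w)))) @ \oo
  --> measure_entropy X mu.
Proof.
rewrite /measure_entropy => H; apply: contrapT => ncvg.
by move: H; rewrite (dvgP ncvg) ltxx.
Qed.

(** * The probability that given cubes are empty *)

Definition vacancy (d c : nat) (G : seq 'rV[int]_d) : set (config d spin) :=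
  [set y | forall v s, v \in G -> in_cube c v s -> y s = None].

Lemma in_cubeD (d c : nat) (t v s : 'rV[int]_d) :
  in_cube c (v + t) (s + t) = in_cube c v s.
Proof.
by apply: eq_forallb => i; rewrite !rwE addrAC lerD2r ltrD2r.
Qed.

Lemma vacancy_shift (d c : nat) (G : seq 'rV[int]_d) (t : 'rV[int]_d) :
  shift_action t @^-1` vacancy c G = vacancy c [seq v + t | v <- G].
Proof.
apply/seteqP; split=> y Hy.
  move=> _ s /mapP[v vG ->]; rewrite -(subrK t s) in_cubeD => /(Hy v _ vG).
  by rewrite /shift_action.
move=> v s vG sv; apply: (Hy (v + t)); first exact: map_f.
by rewrite in_cubeD.
Qed.

Lemma vacancy_finitary (d c : nat) (G : seq 'rV[int]_d) : finitary (vacancy c G).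
Proof.
pose near_all v := projT1 (cid (nearb_seq c (v : 'rV[int]_d))).
exists (flatten [seq near_all v | v <- G]) => x y xy xG v s vG sv.
rewrite xy; first exact: (xG v).
apply/flatten_mapP; exists v => //; rewrite /near_all; case: cid => l /=; apply.
by apply/forallP => i; have := forallP sv i; lia.
Qed.

Lemma vacancy_restr (d c : nat) (S : {fset 'rV[int]_d}) (G : seq 'rV[int]_d) :
  (forall v s, v \in G -> in_cube c v s -> s \in S) ->
  [set y : config d spin | all (empty_cube c (restr S y)) G] = vacancy c G.
Proof.
move=> inS; apply/seteqP; split=> y /=.
  move=> /allP Hy v s vG sv; have sS := inS v s vG sv.
  have /forallP/(_ [` sS]%fset)/implyP/(_ sv) := Hy v vG.
  by rewrite ffunE /=; case: (y s).
move=> Hy; apply/allP => v vG; apply/forallP => s; apply/implyP => sv.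
by rewrite ffunE (Hy v).
Qed.

Lemma ln_prod_bonus (R : realType) (I : Type) (r : seq I) (B : I -> bool) :
  ln (\prod_(i <- r) (1 + (B i)%:R) : R) = \sum_(i <- r) (B i)%:R * ln 2.
Proof.
elim: r => [|i r IH]; first by rewrite !big_nil ln1.
rewrite !big_cons lnM ?posrE ?IH.
- congr (_ + _); case: (B i); rewrite ?mul1r ?mul0r ?addr0 ?ln1//.
- by rewrite ltr_pwDl.
- by apply: prodr_gt0 => j _; rewrite ltr_pwDl.
Qed.

Lemma pairwise_flatten_map (T : eqType) (J : eqType) (r : rel T) (F : J -> seq T) (l : seq J) :
  uniq l -> (forall j, pairwise r (F j)) ->
  (forall j j', j != j' -> allrel r (F j) (F j')) ->
  pairwise r (flatten [seq F j | j <- l]).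
Proof.
move=> + Fp Fr; elim: l => //= j l IH /andP[jl ul]; rewrite pairwise_cat Fp IH//= andbT.
apply/allrelP => x y xF /flatten_mapP[j' j'l yF].
have jj' : j != j' by apply: contraNneq jl => ->.
by have /allrelP := Fr j j' jj'; apply.
Qed.

Section VacancyBound.
Variables (R : realType) (d N q : nat).
Let c := (N.+1 + N.+1 + q)%N.
Let b := (c + c)%N.
Let Y := @spin_system d N.+1 b.
Let kappa : R := (2 ^ (2 ^ d))%:R / q%:R.
Hypothesis d0 : (0 < d)%N.
Hypothesis q0 : (0 < q)%N.
Variable mu : probability (borel_config d spin) R.
Hypothesis mu_inv : is_invariant_probability Y mu.
Hypothesis mu_max : measure_entropy Y mu = top_entropy R Y.

Let pr_shift (E : set (borel_config d spin)) t : measurable E ->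
  pr mu (shift_action t @^-1` E) = pr mu E.
Proof. by move=> mE; rewrite /pr mu_inv.2. Qed.

Let vacancy_measurable G : measurable (vacancy c G : set (borel_config d spin)).
Proof. by apply: finitary_measurable; exact: vacancy_finitary. Qed.

(** A box of side [M * r] is tiled by [M ^ d] boxes of side [r], each holding one translate of the
    cubes of [G]. Gibbs' inequality is applied to the weight [f], which doubles for each translate
    that is empty: [vacant_weight] bounds its sum, and by invariance the mean of [ln (f w)] is
    [M ^ d] times [ln 2 * pr mu (vacancy c G)]. *)
Lemma entropy_vacancy (G : seq 'rV[int]_d) (r M : nat) :
  pairwise (fun v v' => ~~ nearb c v v') G ->
  (forall v i, v \in G -> 1 <= v ord0 i /\ v ord0 i + c%:Z <= r%:Z + 1) ->
  \sum_(w in language (box (fun _ : 'I_d => M * r)%N) Y)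
     - (pr mu (cylinder w) * ln (pr mu (cylinder w))) <=
  ln #|language (box (fun _ : 'I_d => M * r)%N) Y|%:R
  + (M ^ d)%:R * (ln (1 + kappa ^+ size G) - ln 2 * pr mu (vacancy c G)).
Proof.
move=> farG inG; set S := box _; set L := language S Y.
pose J := {ffun 'I_d -> 'I_M}.
pose t (j : J) : 'rV[int]_d := \row_i (r * j i)%N%:Z.
pose Gt j := [seq v + t j | v <- G].
pose Ts := [seq Gt j | j <- enum J].
have far_t j : pairwise (fun v v' => ~~ nearb c v v') (Gt j).
  rewrite pairwise_map; move: farG; apply: sub_pairwise => v v'.
  by rewrite /= nearb_add.
have far_tt j j' : j != j' -> allrel (fun v v' => ~~ nearb c v v') (Gt j) (Gt j').
  move=> jj'; apply/allrelP => _ _ /mapP[v vG ->] /mapP[v' v'G ->].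
  apply/negP => /forallP H; case/eqP: jj'; apply/ffunP => i; apply/val_inj => /=.
  have := H i; rewrite !rwE; have [] := inG v i vG; have [] := inG v' i v'G.
  move: (v ord0 i) (v' ord0 i) (j i : nat) (j' i : nat) => x x' y y' H1 H2 H3 H4 H5.
  have [yy|yy|//] := ltngtP y y'.
    have : (r * y.+1 <= r * y')%N by rewrite leq_mul2l yy orbT.
    by rewrite mulnS; lia.
  have : (r * y'.+1 <= r * y)%N by rewrite leq_mul2l yy orbT.
  by rewrite mulnS; lia.
have insS v s : v \in flatten Ts ++ [::] -> in_cube c v s -> s \in S.
  rewrite cats0 => /flatten_mapP[j _ /mapP[u uG ->]] /forallP H.
  apply/mem_box => i; have := H i; rewrite !rwE; have [] := inG u i uG.
  have := ltn_ord (j i).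
  move: (u ord0 i) (s ord0 i) (j i : nat) => x y z zM H1 H2 H3.
  have : (r * z.+1 <= r * M)%N by rewrite leq_mul2l zM orbT.
  by rewrite mulnS [(M * r)%N]mulnC; lia.
have inT j v s : v \in Gt j -> in_cube c v s -> s \in S.
  move=> vG; apply: insS; rewrite cats0; apply/flatten_mapP.
  by exists j; rewrite ?mem_enum.
have LE : L = vacant c N.+1 b S [::].
  by apply/setP => w; rewrite [in RHS]inE /= andbT /L language_spin.
pose p (w : {ffun S -> spin}) := pr mu (cylinder w).
pose f (w : {ffun S -> spin}) : R := \prod_(T <- Ts) (1 + (all (empty_cube c w) T)%:R).
have clY : closed Y := (spin_system_subshift d N.+1 b).1.
have p1 : \sum_(w in L) p w = 1.
  have := pr_restr (S := S) xpredT clY mu_inv.1.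
  rewrite (_ : [set _ | _] = setT) ?pr_setT; last by apply/seteqP.
  by move=> ->; apply: eq_bigl => w; rewrite andbT.
have f0 w : 0 < f w by apply: prodr_gt0 => T _; rewrite ltr_pwDl.
apply: le_trans (gibbs_inequality (fun w => pr_ge0 mu (cylinder w)) p1 f0) _.
have sizeTs : size Ts = (M ^ d)%N.
  by rewrite size_map -cardE card_ffun !card_ord.
have card0 : 0 < #|L|%:R :> R.
  by rewrite ltr0n language_gt0//; exact: spin_system_nonempty.
have k1 : 0 < 1 + kappa ^+ size G :> R.
  by rewrite ltr_pwDl// exprn_ge0// divr_ge0.
have fL : \sum_(w in L) f w <= (1 + kappa ^+ size G) ^+ (M ^ d) * #|L|%:R.
  rewrite LE -sizeTs; have := @vacant_weight R d N.+1 q S d0 q0 (size G) Ts [::].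
  rewrite expr0 mul1r; apply.
  - by apply/allP => _ /mapP[j _ ->]; rewrite size_map.
  - by rewrite cats0 pairwise_flatten_map ?enum_uniq.
  - exact: insS.
have -> : \sum_(w in L) p w * ln (f w) = (M ^ d)%:R * (ln 2 * pr mu (vacancy c G)).
  transitivity (\sum_(T <- Ts) \sum_(w in L) p w * ((all (empty_cube c w) T)%:R * ln 2)).
    rewrite exchange_big /=; apply: eq_bigr => w _.
    by rewrite /f ln_prod_bonus mulr_sumr.
  rewrite big_map /= -sizeTs size_map -sum1_size natr_sum mulr_suml big_seq [RHS]big_seq.
  apply: eq_bigr => j _; rewrite mul1r.
  rewrite -(pr_shift (t j) (vacancy_measurable G)) vacancy_shift -/(Gt j).
  rewrite -(vacancy_restr (inT j)) (pr_restr (fun w => all (empty_cube c w) (Gt j)) clY mu_inv.1) -/L.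
  rewrite mulr_sumr [RHS]big_mkcondr /=; apply: eq_bigr => w _.
  by case: all; rewrite ?mul0r ?mulr0// mul1r mulrC.
rewrite mulrBr addrA lerB// addrC -[(M ^ d)%:R * _](_ : ln ((1 + kappa ^+ size G) ^+ (M ^ d)) = _); last first.
  by rewrite lnXn// mulr_natl.
rewrite -lnM ?posrE ?exprn_gt0//.
rewrite ler_ln ?posrE//.
  have [w wL] : exists w, w \in L by apply/card_gt0P; rewrite -(ltr0n R).
  rewrite (bigD1 w)//= ltr_pwDl//; apply: sumr_ge0 => u _; exact: ltW.
by rewrite mulr_gt0// exprn_gt0.
Qed.

(** After division by the volume and [M] tending to infinity, the two entropies cancel because [mu]
    is maximal. What remains is [ln 2 * pr mu (vacancy c G) <= ln (1 + kappa ^+ size G)], and the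
    factor 2 comes from [1 / 2 <= ln 2]. *)
Let pr_vacancy_pos (G : seq 'rV[int]_d) (r : nat) :
  pairwise (fun v v' => ~~ nearb c v v') G ->
  (forall v i, v \in G -> 1 <= v ord0 i /\ v ord0 i + c%:Z <= r.+1%:Z + 1) ->
  pr mu (vacancy c G) <= 2 * kappa ^+ size G.
Proof.
move=> farG inG.
have top0 : 0 < top_entropy R Y := top_entropy_spin_gt0 R d N b.
have H1 := top_entropy_cvg_cube (R := R) (spin_system_nonempty d N.+1 b)
  (spin_system_subshift d N.+1 b).2.
have H2 : 0 < measure_entropy Y mu by rewrite mu_max.
move/measure_entropy_cvg: H2; rewrite mu_max => H2.
pose t M := (M.+1 * r.+1)%N.
have tF : t @ \oo --> \oo.
  by move=> B [n _ nB]; exists n => // M nM; apply: nB; rewrite /= /t; move: nM => /=; nia.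
have := cvgB (cvg_comp t _ tF H1) (cvg_comp t _ tF H2); rewrite subrr => /(_ eventually_filter) H3.
pose D := (ln 2 * pr mu (vacancy c G) - ln (1 + kappa ^+ size G)) / r.+1%:R ^+ d.
have k0 : 0 <= kappa ^+ size G by rewrite exprn_ge0// divr_ge0.
have D0 : D <= 0.
  have := ler_cvg_to (cvg_cst D) H3; apply; apply: nearW => M.
  have := entropy_vacancy M.+1 farG inG; rewrite -/(t M).
  rewrite /= !fctE /=; set H := bigop.body _ _ _; set L := ln _ => HL.
  have t0 : 0 < (t M)%:R ^+ d :> R by rewrite exprn_gt0// ltr0n muln_gt0.
  rewrite -mulrBr ler_pdivlMl// /D /t natrM exprMn mulrACA divff; last first.
    by rewrite expf_neq0// pnatr_eq0.
  rewrite mulr1; move: HL; rewrite natrX !mulrBr; lra.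
have {D0} : ln 2 * pr mu (vacancy c G) <= kappa ^+ size G.
  have : ln (1 + kappa ^+ size G) <= kappa ^+ size G.
    by apply: le_ln1Dx; apply: lt_le_trans k0; rewrite ltrN10.
  move: D0; rewrite /D pmulr_lle0 ?invr_gt0 ?exprn_gt0 ?ltr0n//; lra.
have ln2 : 1 / 2 <= ln (2 : R).
  have := @le_ln1Dx R (- (1 / 2)).
  rewrite (_ : 1 - 1 / 2 = 2^-1); last by lra.
  by rewrite lnV ?posrE//; lra.
have := pr_ge0 mu (vacancy c G); nra.
Qed.

Lemma pr_vacancy_le (G : seq 'rV[int]_d) :
  pairwise (fun v v' => ~~ nearb c v v') G ->
  pr mu (vacancy c G) <= 2 * kappa ^+ size G.
Proof.
move=> farG.
pose m := (\max_(v <- G) \max_(i < d) absz ((v : 'rV[int]_d) ord0 i))%N.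
have mG v i : v \in G -> (absz ((v : 'rV[int]_d) ord0 i) <= m)%N.
  move=> vG; apply: leq_trans (leq_bigmax_seq _ vG _) => //.
  exact: (leq_bigmax i).
pose t : 'rV[int]_d := \row_i (m.+1)%:Z.
rewrite -(pr_shift t (vacancy_measurable G)) vacancy_shift -(size_map (fun v => v + t) G).
apply: (@pr_vacancy_pos _ (m + m + c)%N).
  rewrite pairwise_map; move: farG; apply: sub_pairwise => v v'.
  by rewrite /= nearb_add.
by move=> _ i /mapP[v vG ->]; have := mG v i vG; rewrite !rwE; lia.
Qed.
End VacancyBound.

(** * The Peierls argument *)

Section Planar.
Local Open Scope nat_scope.
Variables (r : nat) (f : nat -> nat -> int).

Definition king (x y : nat * nat) : bool :=
  [&& x.1 <= y.1.+1, y.1 <= x.1.+1, x.2 <= y.2.+1 & y.2 <= x.2.+1].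

Hypothesis f_king : forall x y, king x y -> f x.1 x.2 != 0%R ->
  f y.1 y.2 != 0%R -> f x.1 x.2 = f y.1 y.2.

Definition zero_path (x : nat * nat) (l : seq (nat * nat)) : bool :=
  path king x l && all (fun y => f y.1 y.2 == 0%R) (x :: l).

(* A path that starts at (j, 0) and reaches the left, right or top side of the
   square of side r has at least minn j (r - j) steps. *)
Hypothesis short : forall j l, j <= r -> size l = minn j (r - j) ->
  uniq ((j, 0) :: l) -> ~~ zero_path (j, 0) l.

(** The zeros of [f] that are connected through zeros to the bottom side. By [short], the wall
    reaches none of the three other sides. *)
Definition wall (a b : nat) : bool := `[< exists j l,
  [/\ j <= r, zero_path (j, 0) l & last (j, 0) l = (a, b)] >].

Let path_dist x l : path king x l ->
  [/\ x.1 <= (last x l).1 + size l, (last x l).1 <= x.1 + size l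
    & (last x l).2 <= x.2 + size l].
Proof.
elim: l x => [|y l IH] x /=; first by rewrite !addn0.
by move=> /andP[/and4P[]] ? ? ? ? /IH[] ? ? ?; split; lia.
Qed.

(** The path can be made self-avoiding; if it were still long, its initial segment of
    [minn j (r - j)] steps would contradict [short]. *)
Let wall_reach a b : wall a b -> exists2 j, j <= r &
  [/\ j < a + minn j (r - j), a < j + minn j (r - j) & b < minn j (r - j)].
Proof.
move=> /asboolP[j [l [jr /andP[pl zl] el]]]; exists j => //.
move: el; case: (shortenP pl) => l' pl' ul' sl' el.
have sz : size l' < minn j (r - j).
  rewrite ltnNge; apply/negP => big.
  have /negP := short jr (size_takel big) (take_uniq (minn j (r - j)).+1 ul').
  apply; rewrite /zero_path take_path//=.
  move: zl => /= /andP[-> /allP zl]; apply/allP => y /mem_take/sl'; exact: zl.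
have [] := path_dist pl'; rewrite el /=; move: (size l') sz => m; split; lia.
Qed.

Let wall_left b : wall 0 b = false.
Proof. by apply/negP => /wall_reach[j jr []]; lia. Qed.

Let wall_right b : wall r b = false.
Proof. by apply/negP => /wall_reach[j jr []]; lia. Qed.

Let wall_top a : wall a r = false.
Proof. by apply/negP => /wall_reach[j jr []]; lia. Qed.

Let wall_bottom a : a <= r -> ~~ wall a 0 -> f a 0 != 0%R.
Proof.
move=> ar; apply: contraNneq => fa; apply/asboolP; exists a, [::].
by split=> //; rewrite /zero_path /= fa eqxx.
Qed.

Let wall_king a b a' b' : wall a b -> king (a, b) (a', b') -> ~~ wall a' b' ->
  f a' b' != 0%R.
Proof.
move=> /asboolP[j [l [jr /andP[pl zl] el]]] k; apply: contraNneq => fa.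
apply/asboolP; exists j, (rcons l (a', b')).
rewrite last_rcons; split=> //; apply/andP; split.
  by rewrite rcons_path pl el.
by rewrite -rcons_cons all_rcons /= fa eqxx.
Qed.

Local Open Scope ring_scope.

Let h a b : int := if wall a b || wall a.+1 b then f a.+1 b - f a b else 0.
Let v a b : int := if wall a b || wall a b.+1 then f a b.+1 - f a b else 0.

(* The increments h, v restricted to the edges that meet the wall form a closed
   1-form: if one corner of the square is in the wall, then an edge of the square
   that does not meet it joins two non-vanishing neighbours, where f takes equal
   values.  The form vanishes on the left, right and top sides of [0, r]^2, hence its
   sum over the bottom side is 0. *)
Let square a b : h a b + v a.+1 b = v a b + h a b.+1.
Proof.
have [] := boolP [|| wall a b, wall a.+1 b, wall a b.+1 | wall a.+1 b.+1]; last first.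
  by rewrite /h /v; do 4!case: (wall _ _).
move=> Usq.
have nz x y : (a <= x <= a.+1)%N -> (b <= y <= b.+1)%N -> ~~ wall x y -> f x y != 0.
  move=> xa yb; case/or4P: Usq => Uc; apply: (wall_king Uc);
  by apply/and4P; split=> /=; lia.
have eqf x y x' y' : (a <= x <= a.+1)%N -> (b <= y <= b.+1)%N ->
    (a <= x' <= a.+1)%N -> (b <= y' <= b.+1)%N ->
    ~~ wall x y -> ~~ wall x' y' -> f x y = f x' y'.
  move=> xa yb xa' yb' n n'.
  apply: (@f_king (x, y) (x', y')); [|exact: nz|exact: nz].
  by apply/and4P; split=> /=; lia.
have hE y : (b <= y <= b.+1)%N -> h a y = f a.+1 y - f a y.
  move=> yb; rewrite /h; case: ifPn => //; rewrite negb_or => /andP[n n'].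
  by rewrite (eqf a y a.+1 y) ?subrr//; lia.
have vE x : (a <= x <= a.+1)%N -> v x b = f x b.+1 - f x b.
  move=> xa; rewrite /v; case: ifPn => //; rewrite negb_or => /andP[n n'].
  by rewrite (eqf x b x b.+1) ?subrr//; lia.
by rewrite !hE ?vE; lia.
Qed.

Lemma planar_agree : f 0 0 = f r 0 /\ f 0 0 != 0.
Proof.
split; last by apply: wall_bottom; rewrite ?wall_left.
have rows b : (b <= r)%N -> \sum_(0 <= a < r) h a b = \sum_(0 <= a < r) h a 0.
  elim: b => // b IH br; rewrite -IH ?(ltnW br)//; apply/eqP; rewrite -subr_eq0 -sumrB.
  rewrite (eq_bigr (fun a => v a.+1 b - v a b)) => [|a _]; last first.
    by have := square a b; lia.
  by rewrite telescope_sumr// /v !wall_left !wall_right subrr.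
have := rows r (leqnn r); rewrite big1 => [|a _]; last by rewrite /h !wall_top.
(* On the bottom side [h] is the whole increment: every zero there is in the wall, so an edge off
   the wall joins two non-vanishing neighbours and has increment 0. *)
rewrite big_nat (eq_bigr (fun a => f a.+1 0 - f a 0)) => [|a /andP[_ ar]]; last first.
  rewrite /h; case: ifPn => //; rewrite negb_or => /andP[n n'].
  have k : king (a, 0%N) (a.+1, 0%N) by apply/and4P; split=> /=; lia.
  by have /= -> := f_king k (wall_bottom (ltnW ar) n) (wall_bottom ar n'); rewrite subrr.
by rewrite -big_nat telescope_sumr// => /eqP; rewrite eq_sym subr_eq0 => /eqP.
Qed.
End Planar.

(* The precedence of + is immaterial on spin_system N (c + c), where no cube of side
   c contains opposite spins. *)
Definition gsign (d c : nat) (y : config d spin) (s : 'rV[int]_d) : int :=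
  if `[< exists2 t, in_cube c s t & y t = Some true >] then 1
  else if `[< exists2 t, in_cube c s t & y t = Some false >] then -1 else 0.

Lemma gsign_shift (d c : nat) (y : config d spin) (s t : 'rV[int]_d) :
  gsign c (shift_action t y) s = gsign c y (s + t).
Proof.
have E e : (exists2 u, in_cube c s u & shift_action t y u = Some e) =
    (exists2 u, in_cube c (s + t) u & y u = Some e).
  apply: propext; split=> -[u su yu].
    by exists (u + t); rewrite ?in_cubeD.
  exists (u - t); last by rewrite /shift_action subrK.
  by rewrite -(in_cubeD c t) subrK.
by rewrite /gsign !E.
Qed.

Lemma gsign_eq0 (d c : nat) (y : config d spin) (s : 'rV[int]_d) :
  gsign c y s = 0 <-> forall t, in_cube c s t -> y t = None.
Proof.
rewrite /gsign; split=> [|none]; last first.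
  by case: asboolP => [[t /none-> //]|_]; case: asboolP => [[t /none-> //]|].
case: asboolP => // np; case: asboolP => // nm _ t st.
by case E : (y t) => [[]|] //; [case: np|case: nm]; exists t.
Qed.

Lemma gsign_nz (d c : nat) (y : config d spin) (s : 'rV[int]_d) : gsign c y s != 0 ->
  exists e t, [/\ in_cube c s t, y t = Some e & gsign c y s = if e then 1 else -1].
Proof.
rewrite /gsign; case: asboolP => [[t st yt] _|_]; first by exists true, t.
by case: asboolP => [[t st yt] _|//]; exists false, t.
Qed.

(** Sites of two cubes whose corners are at distance at most [c] differ by at most [2c - 1] in each
    coordinate. This is the reason for excluding opposite spins up to [c + c]. *)
Lemma gsign_agree (d N c : nat) (y : config d spin) (s s' : 'rV[int]_d) :
  spin_system N (c + c) y -> nearb c.+1 s s' ->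
  gsign c y s != 0 -> gsign c y s' != 0 -> gsign c y s = gsign c y s'.
Proof.
move=> Yy ss' /gsign_nz[e [t [st yt ->]]] /gsign_nz[e' [t' [st' yt' ->]]].
suff : e = e' by move=> ->.
have [ett|tt'] := eqVneq t t'; first by move: yt'; rewrite -ett yt => -[].
have := Yy t t' (elimN eqP tt'); rewrite yt yt' => /(_ isT isT)/andP[_].
have -> : nearb (c + c) t t'.
  apply/forallP => i; have := forallP ss' i; have := forallP st i.
  by have := forallP st' i; lia.
by rewrite implybF negbK => /eqP[].
Qed.

Lemma gsign_finitary (d c : nat) (s : 'rV[int]_d) :
  exists F : seq 'rV[int]_d, forall x y : config d spin,
    (forall t, t \in F -> y t = x t) -> gsign c y s = gsign c x s.
Proof.
have [F HF] := nearb_seq c s; exists F => x y xy.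
have E e : (exists2 t, in_cube c s t & y t = Some e) =
    (exists2 t, in_cube c s t & x t = Some e).
  have sF t : in_cube c s t -> y t = x t.
    by move=> /forallP st; apply/xy/HF/forallP => i; have := st i; lia.
  by apply: propext; split=> -[t st yt]; exists t => //; rewrite ?sF// -sF.
by rewrite /gsign !E.
Qed.

Lemma gsign_measurable (d c : nat) (P : int -> int -> Prop) (s s' : 'rV[int]_d) :
  measurable ([set y | P (gsign c y s) (gsign c y s')] : set (borel_config d spin)).
Proof.
apply: finitary_measurable.
have [F HF] := gsign_finitary c s; have [F' HF'] := gsign_finitary c s'.
exists (F ++ F') => x y xy /=.
by rewrite (HF x y) ?(HF' x y)// => t tF; apply: xy; rewrite mem_cat tF ?orbT.
Qed.

(** Truncated predecessors repeat entries at the boundary. The list has 9 entries everywhere, and an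
    upper bound on the number of paths is enough. *)
Definition king_nbrs (x : nat * nat) : seq (nat * nat) :=
  [seq ((x.1 + i).-1, (x.2 + j).-1)%N | i <- iota 0 3, j <- iota 0 3].

Fixpoint king_paths (x : nat * nat) (m : nat) : seq (seq (nat * nat)) :=
  if m is m'.+1 then
    flatten [seq [seq y :: l | l <- king_paths y m'] | y <- king_nbrs x]
  else [:: [::]].

Lemma king_pathsS (x : nat * nat) (m : nat) : king_paths x m.+1 =
  flatten [seq [seq y :: l | l <- king_paths y m] | y <- king_nbrs x].
Proof. by []. Qed.

Lemma mem_king_paths (x : nat * nat) (l : seq (nat * nat)) :
  path king x l -> l \in king_paths x (size l).
Proof.
elim: l x => [//|y l IH] x /andP[xy yl]; rewrite king_pathsS.
apply/flatten_mapP; exists y; last by apply: map_f; exact: IH.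
have /and4P[? ? ? ?] := xy; apply/allpairsP.
exists ((y.1.+1 - x.1)%N, (y.2.+1 - x.2)%N).
split; rewrite ?mem_iota; [move=> /=; lia|move=> /=; lia|].
by rewrite [y]surjective_pairing; congr pair; move=> /=; lia.
Qed.

Lemma size_king_paths (x : nat * nat) (m : nat) : size (king_paths x m) = (9 ^ m)%N.
Proof.
elim: m x => [//|m IH] x; rewrite king_pathsS size_flatten /shape -map_comp.
rewrite (eq_map (g := fun=> (9 ^ m)%N)) => [|y]; last by rewrite /= size_map.
by rewrite /= expnS; lia.
Qed.

Lemma geometric_le2 (R : realType) (x : R) (n : nat) : 0 <= x <= 1 / 2 ->
  \sum_(j < n) x ^+ j <= 2.
Proof.
move=> /andP[x0 x2]; elim: n => [|n IH]; first by rewrite big_ord0.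
rewrite big_ord_recl expr0; under eq_bigr do rewrite exprS.
rewrite -mulr_sumr; have : 0 <= \sum_(j < n) x ^+ j by apply: sumr_ge0 => j _; exact: exprn_ge0.
nra.
Qed.

Lemma size_mem_king_paths (x : nat * nat) (m : nat) (l : seq (nat * nat)) :
  l \in king_paths x m -> size l = m.
Proof.
elim: m x l => [|m IH] x l; first by rewrite inE => /eqP ->.
rewrite king_pathsS => /flatten_mapP[y _ /mapP[l' + ->]].
by move=> /IH /= ->.
Qed.

(** * Correlation of the signs of distant cubes *)

Section Correlation.
Variables (R : realType) (d N q : nat).
Let c := (N.+1 + N.+1 + q)%N.
Let b := (c + c)%N.
Let Y := @spin_system d N.+1 b.
Let kappa : R := (2 ^ (2 ^ d))%:R / q%:R.
Hypothesis d1 : (1 < d)%N.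
Hypothesis q0 : (0 < q)%N.
Hypothesis kappa_small : 9 * kappa <= 1 / 2.
Variable mu : probability (borel_config d spin) R.
Hypothesis mu_inv : is_invariant_probability Y mu.
Hypothesis mu_max : measure_entropy Y mu = top_entropy R Y.

Let d0 : (0 < d)%N. Proof. exact: ltnW. Qed.
Let kappa0 : 0 <= kappa. Proof. by rewrite divr_ge0. Qed.

Definition disagree (c' : nat) (s s' : 'rV[int]_d) : set (borel_config d spin) :=
  [set y | ~ (gsign c' y s = gsign c' y s' /\ gsign c' y s != 0)].

Lemma disagree_measurable c' s s' : measurable (disagree c' s s').
Proof. exact: (gsign_measurable c' (fun a a' => ~ (a = a' /\ a != 0)) s s'). Qed.

Let clY : closed Y := (spin_system_subshift d N.+1 b).1.
Let mY : measurable (Y : set (borel_config d spin)).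
Proof. exact: closed_measurable_config. Qed.

Let pr_on_Y (E : set (borel_config d spin)) : measurable E -> pr mu E = pr mu (E `&` Y).
Proof. by move=> mE; apply: pr_setI_full => //; rewrite /pr mu_inv.1. Qed.

Let pos (s : 'rV[int]_d) (i1 i2 : 'I_d) (x : nat * nat) : 'rV[int]_d :=
  s + \row_k (c * ((k == i1) * x.1 + (k == i2) * x.2))%N%:Z.

(** A union bound over the paths forbidden in [planar_agree]: from [(j, 0)] there are at most
    [9 ^ m j] of them, each made of [m j + 1] disjoint empty cubes. Since [(9 * kappa) ^+ m j] is at
    most the sum of the powers [j] and [r - j], two geometric series bounded by 2 give
    [2 * kappa * 4]. *)
Lemma pr_disagree_line (s : 'rV[int]_d) (i1 i2 : 'I_d) (r : nat) : i1 != i2 ->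
  pr mu (disagree c s (s + \row_k (c * ((k == i1) * r))%N%:Z)) <= 8 * kappa.
Proof.
move=> i12; set s' := s + _; pose P := pos s i1 i2.
have P0 : P (0%N, 0%N) = s.
  by apply: row_ext => k; rewrite !rwE /= !muln0 addr0.
have Pr : P (r, 0%N) = s'.
  by apply: row_ext => k; rewrite !rwE /= muln0 addn0.
have i21 : i2 != i1 by rewrite eq_sym.
have P_near x x' : king x x' -> nearb c.+1 (P x) (P x').
  move=> /and4P[? ? ? ?]; apply/forallP => k; rewrite !rwE.
  have [->|ki1] := eqVneq k i1; first by rewrite (negPf i12) mul0n; nia.
  by have [->|ki2] := eqVneq k i2; rewrite ?mul0n ?add0n ?mul1n; nia.
have P_far x x' : x != x' -> ~~ nearb c (P x) (P x').
  move=> xx'; apply: contra xx' => /forallP H; apply/eqP.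
  have := H i1; have := H i2; rewrite !rwE !eqxx (negPf i12) (negPf i21).
  case: x x' {H} => x1 x2 [x1' x2'] /= H2 H1; congr pair; nia.
pose m j := minn j (r - j).
pose paths j := [seq (j, l) | l <- king_paths (j, 0%N) (m j) & uniq ((j, 0%N) :: l)].
pose G (jl : nat * seq (nat * nat)) := [seq P x | x <- (jl.1, 0%N) :: jl.2].
rewrite pr_on_Y; last exact: disagree_measurable.
have mD := measurableI _ _ (disagree_measurable c s s') mY.
apply: (le_trans (pr_cover mu (r := flatten [seq paths j | j <- iota 0 r.+1])
  (F := fun jl => vacancy c (G jl)) mD _ _)).
- by move=> jl; apply: finitary_measurable; exact: vacancy_finitary.
- move=> y [nagree Yy]; apply: contrapT => novac; apply: nagree.
  have [||e nz] := @planar_agree r (fun a a' => gsign c y (P (a, a'))).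
  + move=> [x1 x2] [x1' x2'] /P_near; exact: gsign_agree Yy.
  + move=> j l jr sl ul; apply/negP => /andP[pl /allP zl]; apply: novac.
    exists (j, l).
      apply/flatten_mapP; exists j; first by rewrite mem_iota.
      by rewrite map_f// mem_filter ul (_ : m j = size l) ?mem_king_paths.
    move=> _ t /mapP[x xl ->]; have := zl x xl; rewrite -surjective_pairing.
    by move=> /eqP/gsign_eq0; exact.
  + by rewrite P0 Pr in e nz.
rewrite big_flatten big_map /=.
apply: (@le_trans _ _ (\sum_(j <- iota 0 r.+1) 2 * kappa * (9 * kappa) ^+ m j)).
  rewrite big_seq [leRHS]big_seq; apply: ler_sum => j _.
  rewrite /paths big_map big_filter.
  apply: (@le_trans _ _ (\sum_(l <- king_paths (j, 0%N) (m j)) 2 * kappa ^+ (m j).+1)).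
    rewrite big_mkcond /= big_seq [leRHS]big_seq; apply: ler_sum => l lp.
    case: ifP => [ul|_]; last by rewrite mulr_ge0// exprn_ge0.
    have farG : pairwise (fun v v' => ~~ nearb c v v') (G (j, l)).
      rewrite /G pairwise_map; have ul' : uniq ((j, 0%N) :: l) := ul.
      rewrite uniq_pairwise in ul'; apply: sub_pairwise ul' => x x'.
      exact: P_far.
    have := pr_vacancy_le d0 q0 mu_inv mu_max farG.
    by rewrite size_map /= (size_mem_king_paths lp).
  rewrite big_const_seq count_predT size_king_paths iter_addr addr0.
  rewrite -[_ *+ _]mulr_natr natrX.
  suff -> : 2 * kappa ^+ (m j).+1 * 9 ^+ m j = 2 * kappa * (9 * kappa) ^+ m j by [].
  by move: (kappa) (m j) => k mm; rewrite exprMn exprS; ring.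
rewrite -mulr_sumr -/(index_iota 0 r.+1) big_mkord.
have x0 : 0 <= 9 * kappa by rewrite mulr_ge0.
have x01 : 0 <= 9 * kappa <= 1 / 2 by rewrite x0.
suff : \sum_(j < r.+1) (9 * kappa) ^+ m j <= 4 by nra.
apply: (@le_trans _ _ (\sum_(j < r.+1) (9 * kappa) ^+ j + \sum_(j < r.+1) (9 * kappa) ^+ (r - j)%N)).
  rewrite -big_split; apply: ler_sum => j _ /=; rewrite /m.
  have [h|h] := leqP j (r - j); first by rewrite lerDl exprn_ge0.
  by rewrite lerDr exprn_ge0.
rewrite [X in _ + X](reindex_inj rev_ord_inj) /=.
rewrite [X in _ + X](eq_bigr (fun j : 'I_r.+1 => (9 * kappa) ^+ j)) => [|j _]; last first.
  by rewrite subSS subKn// -ltnS.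
by have := geometric_le2 r.+1 x01; lra.
Qed.

Definition unoccupied (c' : nat) (s : 'rV[int]_d) : set (borel_config d spin) :=
  [set y | gsign c' y s = 0].

Lemma unoccupied_measurable c' s : measurable (unoccupied c' s).
Proof. exact: (gsign_measurable c' (fun a _ => a = 0) s s). Qed.

Lemma pr_unoccupied_le (s : 'rV[int]_d) : pr mu (unoccupied c s) <= 2 * kappa.
Proof.
have := @pr_vacancy_le R d N q d0 q0 mu mu_inv mu_max [:: s] isT.
rewrite expr1; apply: le_trans; apply: pr_le; first exact: unoccupied_measurable.
  by apply: finitary_measurable; exact: vacancy_finitary.
by move=> y /gsign_eq0 ys _ t /[!inE]/eqP->; exact: ys.
Qed.

Let pr_disagree_trans (s s' s'' : 'rV[int]_d) :
  pr mu (disagree c s s'') <= pr mu (disagree c s s') + pr mu (disagree c s' s'').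
Proof.
have m1 := disagree_measurable c s s'; have m2 := disagree_measurable c s' s''.
apply: le_trans (pr_setU_le mu m1 m2); apply: pr_le.
- exact: disagree_measurable.
- exact: measurableU.
move=> y n; apply: contrapT => /not_orP[/contrapT[e1 z1] /contrapT[e2 z2]].
by apply: n; rewrite e1 e2; split=> //; rewrite -e2 -e1.
Qed.

Let pr_disagree_grid (v : 'I_d -> nat) (k : nat) : (k <= d)%N ->
  pr mu (disagree c 0 (\row_i (if (i < k)%N then c * v i else 0)%N%:Z)) <=
    k%:R * (8 * kappa) + 2 * kappa.
Proof.
elim: k => [_|k IH kd].
  rewrite mul0r add0r; apply: le_trans (pr_unoccupied_le 0); apply: pr_le.
  - exact: disagree_measurable.
  - exact: unoccupied_measurable.
  move=> y n; apply: contrapT => z; apply: n; split; last exact/eqP.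
  by congr gsign; apply: row_ext => i; rewrite !rwE.
(* The path moves along [i1]; [i2] is any other axis, which spans with it the plane of the Peierls
   argument and exists because [d > 1]. *)
pose i1 := Ordinal kd; pose i2 : 'I_d := if k is 0 then Ordinal d1 else Ordinal d0.
have i12 : i1 != i2 by rewrite -val_eqE /= /i2; case: (k).
apply: le_trans (pr_disagree_trans 0
  (\row_i (if (i < k)%N then c * v i else 0)%N%:Z) _) _.
rewrite -natr1 mulrDl mul1r addrAC; apply: lerD; first exact: IH (ltnW kd).
set u := \row_i _; have := pr_disagree_line u (v i1) i12.
suff -> : u + \row_i (c * ((i == i1) * v i1))%N%:Z =
  \row_i (if (i < k.+1)%N then c * v i else 0)%N%:Z by [].
apply: row_ext => i; rewrite !rwE; have [->|ik] := eqVneq i i1.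
  by rewrite /= ltnn ltnSn mul1n add0r.
have -> : (i < k.+1)%N = (i < k)%N.
  by rewrite -val_eqE /= in ik; rewrite ltnS leq_eqVlt (negPf ik).
by rewrite mul0n muln0 addr0.
Qed.

(** Rounding [t] down to the grid of mesh [c] gives a cube whose sign agrees with that at [t] unless
    one is empty. The grid costs [8 * kappa] per axis, and emptiness at the origin and at [t] costs
    [2 * kappa] each. *)
Lemma pr_disagree_le (t : 'rV[int]_d) : (forall i, 0 <= t ord0 i) ->
  pr mu (disagree c 0 t) <= (8 * d + 4)%:R * kappa.
Proof.
move=> t0; pose v i := (absz (t ord0 i) %/ c)%N.
pose w : 'rV[int]_d := \row_i (c * v i)%N%:Z.
have c0 : (0 < c)%N by [].
have wt : nearb c.+1 w t.
  apply/forallP => i; rewrite !rwE /v; have := t0 i.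
  have := divn_eq (absz (t ord0 i)) c; have := ltn_pmod (absz (t ord0 i)) c0.
  by move: (t ord0 i) => ti; lia.
have wE : w = \row_i (if (i < d)%N then c * v i else 0)%N%:Z.
  by apply: row_ext => i; rewrite !rwE ltn_ord.
have m1 := disagree_measurable c 0 w; have m2 := unoccupied_measurable c t.
rewrite pr_on_Y; last exact: disagree_measurable.
apply: (@le_trans _ _ (pr mu (disagree c 0 w `|` unoccupied c t))).
  apply: pr_le.
  - apply: measurableI => //; exact: disagree_measurable.
  - exact: measurableU.
  move=> y [n Yy]; apply: contrapT => /not_orP[/contrapT[e1 z1] /eqP z2].
  apply: n; split=> //; rewrite e1; apply: gsign_agree Yy wt _ z2.
  by rewrite -e1.
apply: le_trans (pr_setU_le mu m1 m2) _.
have := pr_disagree_grid v (leqnn d); rewrite -wE.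
have := pr_unoccupied_le t; rewrite natrD natrM; lra.
Qed.
End Correlation.

(** * Averaged mixtures *)

Lemma mul_ln_ge (R : realType) (a b : R) : 0 <= a -> 0 < b -> a - b <= a * (ln a - ln b).
Proof.
move=> a0 b0; have [->|an0] := eqVneq a 0; first by rewrite mul0r sub0r oppr_le0 ltW.
have {an0} a0' : 0 < a by rewrite lt_neqAle eq_sym an0.
have x0 : 0 < b / a by rewrite divr_gt0.
have := @le_ln1Dx R (b / a - 1); rewrite addrCA subrr addr0 ln_div ?posrE//.
have -> : -1 < b / a - 1 by lra.
move=> /(_ isT) H.
have : a * (ln b - ln a) <= a * (b / a - 1) by rewrite ler_pM2l.
by rewrite mulrBr mulrBr mulrBr mulr1 (mulrC a (b / a)) divfK ?gt_eqF//; lra.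
Qed.

Lemma entropy_subadditive (R : realType) (a b : R) : 0 <= a -> 0 <= b ->
  - ((a + b) * ln (a + b)) <= - (a * ln a) + - (b * ln b).
Proof.
move=> a0 b0; rewrite mulrDl opprD.
have le_ln x y : 0 <= x -> 0 <= y -> x * ln x <= x * ln (x + y) :> R.
  move=> x0 y0; have [->|xn0] := eqVneq x 0; first by rewrite !mul0r.
  have {}x0 : 0 < x by rewrite lt_neqAle eq_sym xn0.
  by rewrite ler_pM2l// ler_ln ?posrE ?lerDl// ltr_pwDl.
by apply: lerD; rewrite lerN2; [|rewrite addrC]; exact: le_ln.
Qed.

(** Midpoint concavity of [- x ln x], obtained by comparing [a] and [b] with their mean through
    [mul_ln_ge]. *)
Lemma entropy_concave (R : realType) (a b : R) : 0 <= a -> 0 <= b ->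
  - (a * ln a) + - (b * ln b) <= - ((a + b) * ln (a + b)) + (a + b) * ln 2.
Proof.
move=> a0 b0; have [ab0|abn0] := eqVneq (a + b) 0.
  have a00 : a = 0 by lra.
  have b00 : b = 0 by lra.
  by rewrite a00 b00 !(addr0, mul0r, oppr0).
have c0 : 0 < (a + b) / 2.
  by rewrite divr_gt0// lt_neqAle eq_sym abn0 addr_ge0.
have ab0 : 0 < a + b by lra.
have := mul_ln_ge a0 c0; have := mul_ln_ge b0 c0.
by rewrite ln_div ?posrE//; nra.
Qed.

Lemma entropy_le_card (R : realType) (I : finType) (A : {set I}) (p : I -> R) :
  (forall i, 0 <= p i) -> \sum_(i in A) p i = 1 ->
  \sum_(i in A) - (p i * ln (p i)) <= ln #|A|%:R.
Proof.
move=> p0 p1; have := gibbs_inequality p0 p1 (fun=> ltr01).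
rewrite sumr_const [X in _ - X]big1 ?subr0// => i _.
by rewrite ln1 mulr0.
Qed.

(** Both pairs are compared with their common sum: concavity costs [ln 2] per unit of mass, of which
    there are 2, subadditivity splits the sum into [p1] and [p2], and the entropy of [p2] is at most
    [ln #|A|]. *)
Lemma entropy_mix (R : realType) (I : finType) (A : {set I}) (p p' p1 p2 : I -> R) :
  (forall i, 0 <= p i) -> (forall i, 0 <= p' i) ->
  (forall i, 0 <= p1 i) -> (forall i, 0 <= p2 i) ->
  (forall i, p i + p' i = p1 i + p2 i) ->
  \sum_(i in A) p i = 1 -> \sum_(i in A) p' i = 1 -> \sum_(i in A) p1 i = 1 ->
  \sum_(i in A) - (p i * ln (p i)) + \sum_(i in A) - (p' i * ln (p' i)) <=
  \sum_(i in A) - (p1 i * ln (p1 i)) + ln #|A|%:R + 2 * ln 2.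
Proof.
move=> p0 p'0 p10 p20 pp sp sp' sp1.
have sp2 : \sum_(i in A) p2 i = 1.
  have : \sum_(i in A) (p i + p' i) = \sum_(i in A) (p1 i + p2 i) by exact: eq_bigr.
  by rewrite !big_split /= sp sp' sp1; lra.
have H2 := entropy_le_card p20 sp2.
rewrite -big_split /=; apply: (@le_trans _ _ (\sum_(i in A)
  (- (p1 i * ln (p1 i)) + - (p2 i * ln (p2 i)) + (p i + p' i) * ln 2))).
  apply: ler_sum => i _; apply: le_trans (entropy_concave (p0 i) (p'0 i)) _.
  by rewrite lerD2r pp; exact: entropy_subadditive.
by rewrite !big_split /= -mulr_suml big_split /= sp sp'; lra.
Qed.

Lemma ultra_bounded_cvg (R : realType) (U : set_system nat) (x : nat -> R) (a b : R) :
  UltraFilter U -> (forall n, a <= x n <= b) -> exists l : R, x @ U --> l.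
Proof.
move=> UU xab.
have FU : ProperFilter (x @ U) by apply: fmap_proper_filter; exact: ultra_proper.
have xU : (x @ U) `[a, b]%classic.
  apply: (@filterS _ U _ setT) => [n _|]; last exact: filterT.
  by rewrite /= in_itv /= xab.
have [l [_ cl]] := @segment_compact R a b (x @ U) FU xU.
exists l => V Vl; have [//|UV] := in_ultra_setVsetC (x @^-1` V) UU.
by have [r [nVr Vr]] := cl (~` V) V UV Vl.
Qed.

(** The last hypothesis is continuity at the empty set along tails of disjoint unions, which
    upgrades finite additivity to sigma-additivity. *)
Lemma probability_exists (disp : measure_display) (T : measurableType disp)
    (R : realType) (m : set T -> R) :
  (forall A, measurable A -> 0 <= m A) -> m setT = 1 ->
  (forall A B, measurable A -> measurable B -> A `&` B = set0 ->
     m (A `|` B) = m A + m B) ->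
  (forall F : nat -> set T, (forall i, measurable (F i)) -> trivIset setT F ->
     m (\bigcup_k F k `\` \big[setU/set0]_(i < n) F i) @[n --> \oo] --> 0) ->
  exists nu : probability T R, forall A, measurable A -> nu A = (m A)%:E.
Proof.
move=> m_ge0 mT madd mtail.
(* The value 0 off the sigma-algebra makes [f] nonnegative on all sets, as the measure structure
   demands. *)
pose f (A : set T) : \bar R := if `[< measurable A >] then (m A)%:E else 0%E.
have fE A : measurable A -> f A = (m A)%:E by move=> mA; rewrite /f asboolT.
have m0 : m set0 = 0.
  have := madd set0 set0 measurable0 measurable0 (setI0 _); rewrite setU0; lra.
have f0 : f set0 = 0%E by rewrite fE// m0.
have f_ge0 A : (0 <= f A)%E.
  by rewrite /f; case: asboolP => // mA; rewrite lee_fin m_ge0.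
have mbig (F : nat -> set T) n : (forall i, measurable (F i)) -> trivIset setT F ->
    m (\big[setU/set0]_(i < n) F i) = \sum_(i < n) m (F i).
  move=> mF tF; elim: n => [|n IH]; first by rewrite !big_ord0.
  rewrite !big_ord_recr /= madd ?IH//; first exact: bigsetU_measurable.
  rewrite -subset0 => t [] /=; rewrite -bigcup_mkord => -[i /= ilt Fi] Fn.
  have := tF i n I I; move=> e; have : F i `&` F n !=set0 by exists t.
  by move=> /e ein; rewrite ein ltnn in ilt.
have fsigma : semi_sigma_additive f.
  move=> F mF tF mUF; rewrite fE//.
  have -> : (fun n => (\sum_(0 <= i < n) f (F i))%E) =
      (fun n => (m (\bigcup_k F k) -
        m (\bigcup_k F k `\` \big[setU/set0]_(i < n) F i))%:E).
    apply: funext => n; rewrite big_mkord (eq_bigr (fun i : 'I_n => (m (F i))%:E)) => [|i _]; last exact: fE.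
    rewrite sumEFin -mbig//; congr EFin.
    have mB : measurable (\big[setU/set0]_(i < n) F i) by exact: bigsetU_measurable.
    have BU : \big[setU/set0]_(i < n) F i `<=` \bigcup_k F k.
      by rewrite -bigcup_mkord => t [i _ Fi]; exists i.
    have dis : \big[setU/set0]_(i < n) F i `&`
        (\bigcup_k F k `\` \big[setU/set0]_(i < n) F i) = set0.
      by rewrite -subset0 => t [? []].
    by have := madd _ _ mB (measurableD mUF mB) dis; rewrite setDUK// => ->; rewrite addrK.
  apply: cvg_EFin; first exact: nearW.
  rewrite -[X in _ --> X]subr0; apply: cvgB; first exact: cvg_cst.
  exact: mtail.
pose mu1 := isMeasure.Build disp T R f f0 f_ge0 fsigma.
pose mu : {measure set T -> \bar R} := HB.pack f mu1.
have muT : mu setT = 1%E by rewrite /= fE// mT.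
pose mu2 := Measure_isProbability.Build disp T R mu muT.
pose nu : probability T R := HB.pack f mu1 mu2.
by exists nu.
Qed.

Lemma continuous_preimage_measurable (d : nat) (A B : finPointedType)
    (f : config d A -> config d B) (E : set (borel_config d B)) : continuous f ->
  measurable E -> measurable (f @^-1` E : set (borel_config d A)).
Proof.
move=> cf; apply: (@smallest_sub _ (sigma_algebra setT) open
  [set E | measurable (f @^-1` E : set (borel_config d A))]); last first.
  by move=> O oO; apply: open_measurable_config; move/continuousP: cf; apply.
split=> [|O /= mO|O mO] /=; first by rewrite preimage_set0.
- by rewrite setTD preimage_setC; exact: measurableC.
- by rewrite preimage_bigcup; apply: bigcup_measurable => k _; exact: mO.
Qed.

Lemma shift_continuous (d : nat) (A : finType) (t : 'rV[int]_d) :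
  continuous (shift_action t : config d A -> config d A).
Proof.
apply: finitary_continuous => s; exists [:: s + t] => x y xy.
by rewrite /shift_action xy// inE.
Qed.

(** * Averages over boxes *)

Section BoxAverages.
Variables (R : realType) (d : nat).
Implicit Types (f g : 'rV[int]_d -> R) (s t : 'rV[int]_d) (l : seq 'I_d).

Definition unit_vec (i : 'I_d) : 'rV[int]_d := delta_mx 0 i.

Definition line_average (n : nat) (i : 'I_d) f s : R :=
  n.+1%:R^-1 * \sum_(k < n.+1) f (s + unit_vec i *+ k).

(** A box average written as iterated one-dimensional averages, so that its properties follow by
    induction on the list of axes. *)
Definition average n l f := foldr (line_average n) f l.

Lemma averageD n l f g s :
  average n l (fun s => f s + g s) s = average n l f s + average n l g s.
Proof.
elim: l s => //= i l IH s; rewrite /line_average -mulrDr -big_split.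
by congr (_ * _); apply: eq_bigr => k _; exact: IH.
Qed.

Lemma average_translate n l f t s :
  average n l (fun s => f (s + t)) s = average n l f (s + t).
Proof.
elim: l s => //= i l IH s; rewrite /line_average; congr (_ * _).
by apply: eq_bigr => k _; rewrite IH addrAC.
Qed.

(** The average at [s] only sees sites reached from [s] by positive steps, so bounds on the
    nonnegative orthant suffice at the origin. *)
Lemma average_bound n l f (D : 'rV[int]_d -> Prop) (a b : R) :
  (forall s i, D s -> D (s + unit_vec i)) ->
  (forall s, D s -> a <= f s <= b) ->
  forall s, D s -> a <= average n l f s <= b.
Proof.
move=> DD fab; elim: l => [|i l IH] s Ds /=; first exact: fab.
have Dk k : D (s + unit_vec i *+ k).
  by elim: k => [|k IHk]; rewrite ?addr0// mulrSr addrA; exact: DD.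
have n0 : 0 < n.+1%:R :> R by rewrite ltr0n.
rewrite /line_average ler_pdivlMl// ler_pdivrMl//; apply/andP; split.
  rewrite mulr_natl -[X in _ *+ X]card_ord -sumr_const.
  by apply: ler_sum => k _; have /andP[] := IH _ (Dk k).
rewrite mulr_natl -[X in _ *+ X]card_ord -sumr_const.
by apply: ler_sum => k _; have /andP[] := IH _ (Dk k).
Qed.

(** Along the axis [i] the difference of the two sums telescopes to its two end terms; averaging
    along the other axes preserves the bound. *)
Lemma average_increment n l f (b : R) i s : i \in l ->
  (forall s, 0 <= f s <= b) ->
  `|average n l f s - average n l f (s + unit_vec i)| <= b / n.+1%:R.
Proof.
move=> + fb; have n0 : 0 < n.+1%:R :> R by rewrite ltr0n.
have ab l' s' : 0 <= average n l' f s' <= b.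
  by apply: (@average_bound n l' f (fun=> True) 0 b).
elim: l s => //= j l IH s; rewrite inE => jl.
rewrite /line_average -mulrBr normrM gtr0_norm ?invr_gt0// mulrC ler_pM2r ?invr_gt0//.
rewrite -sumrB; have [ij|ij] := eqVneq i j.
  rewrite -ij (eq_bigr (fun k : 'I_n.+1 => - (average n l f (s + unit_vec i *+ k.+1)
     - average n l f (s + unit_vec i *+ k)))) => [|k _]; last first.
    by rewrite opprB mulrSr addrA addrAC.
  rewrite sumrN normrN -(big_mkord xpredT (fun k => average n l f (s + unit_vec i *+ k.+1)
     - average n l f (s + unit_vec i *+ k))) telescope_sumr//.
  have := ab l (s + unit_vec i *+ n.+1); have := ab l (s + unit_vec i *+ 0).
  by rewrite ler_norml => /andP[? ?] /andP[? ?]; lra.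
move: jl; rewrite (negPf ij) /= => il.
apply: le_trans (ler_norm_sum _ _ _) _.
apply: (@le_trans _ _ (\sum_(k < n.+1) (b / n.+1%:R))).
  apply: ler_sum => k _; rewrite (addrAC s); exact: IH.
by rewrite sumr_const card_ord -[_ *+ _]mulr_natr divfK ?gt_eqF.
Qed.
End BoxAverages.

Definition flip (d : nat) (y : config d spin) : config d spin :=
  fun s => omap negb (y s).

Lemma flipK (d : nat) : involutive (@flip d).
Proof.
by move=> y; apply: funext => s; rewrite /flip; case: (y s) => //= e; rewrite negbK.
Qed.

Lemma flip_continuous (d : nat) : continuous (@flip d).
Proof.
by apply: finitary_continuous => s; exists [:: s] => x y xy; rewrite /flip xy// inE.
Qed.

Lemma flip_spin_system (d N b : nat) (y : config d spin) :
  spin_system N b y -> spin_system N b (flip y).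
Proof.
move=> Yy; rewrite /spin_system /flip /= => s t st ys yt.
have := Yy s t st; case: (y s) ys => // e _; case: (y t) yt => //= e' _.
by move=> /(_ isT isT) /andP[-> /implyP H]; apply/implyP => n; apply: H; case: e e' n => [] [].
Qed.

Lemma flip_system_preimage (d N b : nat) :
  @flip d @^-1` spin_system N b = spin_system N b.
Proof.
apply/seteqP; split=> y /=; last exact: flip_spin_system.
by move/flip_spin_system; rewrite flipK.
Qed.

Lemma cvg0_bound (R : realType) (x e : nat -> R) :
  (forall n, 0 <= x n <= e n) -> e @ \oo --> 0 -> x @ \oo --> 0.
Proof.
move=> xe e0; apply: (squeeze_cvgr _ (cvg_cst 0) e0); exact: nearW.
Qed.

Lemma pr_tail (R : realType) (disp : measure_display) (T : measurableType disp)
    (mu : probability T R) (F : nat -> set T) :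
  (forall i, measurable (F i)) -> trivIset setT F ->
  pr mu (\bigcup_k F k `\` \big[setU/set0]_(i < n) F i) @[n --> \oo] --> 0.
Proof.
move=> mF tF; pose B n := \bigcup_k F k `\` \big[setU/set0]_(i < n) F i.
have mU : measurable (\bigcup_k F k) by exact: bigcup_measurable.
have mB n : measurable (B n) by apply: measurableD => //; exact: bigsetU_measurable.
have B0 : \bigcap_n B n = set0.
  rewrite -subset0 => t Bt; have [[k _ Fk] _] := Bt 0%N I.
  have [_] := Bt k.+1 I; apply; rewrite -bigcup_mkord; exists k => //=.
have Bdec : nonincreasing_seq B.
  move=> n m nm; apply/subsetPset => t [Ut nFt]; split=> // Ft; apply: nFt.
  move: Ft; rewrite -!bigcup_mkord => -[i /= im Fi]; exists i => //=.
  exact: leq_trans nm.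
have := nonincreasing_cvg_mu (mu := mu) _ mB _ Bdec.
rewrite B0 measure0 => H.
have {}H : mu \o B @ \oo --> (0 : \bar R)%E.
  by apply: H; rewrite ?B0// (le_lt_trans (probability_le1 _ (mB 0%N)))// ltry.
exact: (fine_cvg H).
Qed.

(** * Invariant limits of conditionally flipped measures *)

Section Mixture.
Variables (R : realType) (d N b : nat).
Let Y := @spin_system d N.+1 b.
Variable mu : probability (borel_config d spin) R.
Hypothesis mu_inv : is_invariant_probability Y mu.
Variable T : 'rV[int]_d -> set (borel_config d spin).
Hypothesis mT : forall s, measurable (T s).
Hypothesis T_shift : forall s t, shift_action t @^-1` T s = T (s + t).

Implicit Types A : set (borel_config d spin).

(** The law of the random field that is kept when [T s] occurs and flipped otherwise. *)
Definition mass A s : R := pr mu (A `&` T s) + pr mu (@flip d @^-1` A `&` ~` T s).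

Let mflip A : measurable A -> measurable (@flip d @^-1` A : set (borel_config d spin)).
Proof. by move=> mA; apply: continuous_preimage_measurable mA; exact: flip_continuous. Qed.

Let mshift t A : measurable A ->
  measurable (shift_action t @^-1` A : set (borel_config d spin)).
Proof. by move=> mA; apply: continuous_preimage_measurable mA; exact: shift_continuous. Qed.

Let mTC s : measurable (~` T s).
Proof. exact: measurableC. Qed.

Let mass_le A s : measurable A -> mass A s <= pr mu A + pr mu (@flip d @^-1` A).
Proof.
move=> mA; have mfA := mflip mA; apply: lerD.
  exact: pr_setIl.
exact: pr_setIl.
Qed.

Let mass_bound A s : measurable A -> 0 <= mass A s <= 2.
Proof.
move=> mA; rewrite addr_ge0 ?pr_ge0//=; apply: le_trans (mass_le s mA) _.
by have := pr_le1 mu mA; have := pr_le1 mu (mflip mA); lra.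
Qed.

Let massD A A' s : measurable A -> measurable A' -> A `&` A' = set0 ->
  mass (A `|` A') s = mass A s + mass A' s.
Proof.
move=> mA mA' AA'; have mfA := mflip mA; have mfA' := mflip mA'.
have e1 : pr mu ((A `|` A') `&` T s) = pr mu (A `&` T s) + pr mu (A' `&` T s).
  rewrite setIUl; apply: pr_setU; [exact: measurableI|exact: measurableI|].
  by rewrite -subset0 => y [[? ?] [? ?]]; rewrite -AA'.
have e2 : pr mu (@flip d @^-1` (A `|` A') `&` ~` T s) =
    pr mu (@flip d @^-1` A `&` ~` T s) + pr mu (@flip d @^-1` A' `&` ~` T s).
  rewrite preimage_setU setIUl; apply: pr_setU;
    [exact: measurableI|exact: measurableI|].
  rewrite -subset0 => y [[A1 ?] [A2 ?]]; have : (A `&` A') (flip y) by [].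
  by rewrite AA'.
by rewrite /mass e1 e2 addrACA.
Qed.

Let mass_setT s : mass setT s = 1.
Proof.
rewrite /mass preimage_setT !setTI -pr_setU ?setUv ?pr_setT//.
exact: setICr.
Qed.

(** Shifting the event amounts to moving the site at which the decision to flip is taken; averaging
    over that site therefore produces invariance. *)
Let mass_shift A t s : measurable A -> mass (shift_action t @^-1` A) (s + t) = mass A s.
Proof.
move=> mA; rewrite /mass -T_shift.
have h (E : set (borel_config d spin)) : measurable E -> pr mu (shift_action t @^-1` E) = pr mu E.
  by move=> mE; rewrite /pr mu_inv.2.
congr (_ + _).
  by rewrite -(h (A `&` T s))//; exact: measurableI.
rewrite -(h (@flip d @^-1` A `&` ~` T s))//.
by apply: measurableI => //; exact: mflip.
Qed.

Let avg n (A : set (borel_config d spin)) := average n (enum 'I_d) (mass A) 0.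

Let avg_bound n A : measurable A -> 0 <= avg n A <= 2.
Proof.
by move=> mA; apply: (@average_bound _ _ n _ _ (fun=> True)) => // s _; exact: mass_bound.
Qed.

(* The bound by mu and its flip transfers continuity along decreasing sequences to
   the ultrafilter limit, which is a priori only finitely additive. *)
Lemma mixture : exists nu : probability (borel_config d spin) R,
  [/\ is_invariant_probability Y nu,
      forall A : set (borel_config d spin), measurable A -> pr nu A <= pr mu A + pr mu (@flip d @^-1` A)
    & forall (A : set (borel_config d spin)) (x : R), measurable A ->
        (forall s : 'rV[int]_d, (forall i, 0 <= s ord0 i) -> mass A s <= x) -> pr nu A <= x].
Proof.
(* One ultrafilter makes the averages of all Borel events converge at once, whereas a diagonal
   subsequence would serve only countably many. *)
have [U [UU Uoo]] := ultraFilterLemma eventually_filter.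
have UP : ProperFilter U by exact: ultra_proper.
pose m (A : set (borel_config d spin)) : R := lim (avg n A @[n --> U]).
have m_cvg (A : set (borel_config d spin)) : measurable A -> avg n A @[n --> U] --> m A.
  move=> mA; have [l Hl] := ultra_bounded_cvg UU (fun n => avg_bound n mA).
  by apply/cvg_ex; exists l.
have m_le (A : set (borel_config d spin)) x : measurable A -> (forall n, avg n A <= x) -> m A <= x.
  move=> mA Ax; apply: (ler_cvg_to (m_cvg A mA) (cvg_cst x)); exact: nearW.
have m_ge (A : set (borel_config d spin)) x : measurable A -> (forall n, x <= avg n A) -> x <= m A.
  move=> mA Ax; apply: (ler_cvg_to (cvg_cst x) (m_cvg A mA)); exact: nearW.
have m_dom (A : set (borel_config d spin)) : measurable A -> m A <= pr mu A + pr mu (@flip d @^-1` A).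
  move=> mA; apply: m_le => // n.
  have hb s : 0 <= mass A s <= pr mu A + pr mu (@flip d @^-1` A).
    by rewrite mass_le// andbT; have /andP[] := mass_bound s mA.
  have := @average_bound _ _ n (enum 'I_d) (mass A) (fun=> True) _ _
    (fun _ _ _ => I) (fun s _ => hb s) 0 I.
  by case/andP.
have m_ge0 (A : set (borel_config d spin)) : measurable A -> 0 <= m A.
  by move=> mA; apply: m_ge => // n; have /andP[] := avg_bound n mA.
have avg_cst (A : set (borel_config d spin)) x n : (forall s, mass A s = x) -> avg n A = x.
  move=> Ax; have hx s : x <= mass A s <= x by rewrite Ax lexx.
  have := @average_bound _ _ n (enum 'I_d) (mass A) (fun=> True) _ _
    (fun _ _ _ => I) (fun s _ => hx s) 0 I.
  by rewrite andbC => /le_anti.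
have m_cst (A : set (borel_config d spin)) x : measurable A -> (forall s, mass A s = x) -> m A = x.
  move=> mA Ax; apply/le_anti/andP; split; [apply: m_le|apply: m_ge] => // n;
  by rewrite (avg_cst A x).
have m_add (A A' : set (borel_config d spin)) : measurable A -> measurable A' -> A `&` A' = set0 ->
    m (A `|` A') = m A + m A'.
  move=> mA mA' AA'; have mU := measurableU _ _ mA mA'.
  apply: (@cvg_unique _ (@Rhausdorff R) _ _ _ _ (m_cvg _ mU)).
  rewrite (_ : (fun n => avg n (A `|` A')) = (fun n => avg n A + avg n A')).
    by apply: cvgD; exact: m_cvg.
  apply: funext => n; rewrite /avg -averageD; congr (average _ _ _ _).
  by apply: funext => s; exact: massD.
have [||||nu nuE] := @probability_exists _ _ R m.
- exact: m_ge0.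
- exact: m_cst.
- exact: m_add.
- move=> F mF tF.
  apply: (cvg0_bound (e := fun n =>
    pr mu (\bigcup_k F k `\` \big[setU/set0]_(i < n) F i) +
    pr mu (@flip d @^-1` (\bigcup_k F k `\` \big[setU/set0]_(i < n) F i)))).
    move=> n; have mB : measurable (\bigcup_k F k `\` \big[setU/set0]_(i < n) F i).
      by apply: measurableD; [exact: bigcup_measurable|exact: bigsetU_measurable].
    by rewrite m_ge0//= m_dom.
  rewrite -[X in _ --> X]addr0; apply: cvgD; first exact: pr_tail.
  rewrite (_ : (fun n => _) = (fun n => pr mu (\bigcup_k (@flip d @^-1` F k) `\`
      \big[setU/set0]_(i < n) (@flip d @^-1` F i)))).
    apply: pr_tail => [i|]; first exact: mflip.
    by move=> i j _ _ [y [Fi Fj]]; apply: tF => //; exists (flip y).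
  apply: funext => n; congr pr; rewrite -[LHS]/(@flip d @^-1` (\bigcup_k F k) `\`
      @flip d @^-1` (\big[setU/set0]_(i < n) F i)).
  rewrite preimage_bigcup; congr (_ `\` _).
  by elim: n => [|n IH]; rewrite ?big_ord0 ?preimage_set0// !big_ord_recr -IH.
have prE (A : set (borel_config d spin)) : measurable A -> pr nu A = m A.
  by move=> mA; rewrite /pr nuE.
(* The translations that preserve [m] form a group, so the unit vectors are enough; for these the
   averages differ by at most [2 / (n + 1)]. *)
pose G t := forall A : set (borel_config d spin), measurable A ->
  m (shift_action t @^-1` A) = m A.
have GD t t' : G t -> G t' -> G (t + t').
  move=> Gt Gt' A mA; rewrite -(Gt' A mA) -(Gt _ (mshift t' mA)).
  congr m; apply/seteqP; split=> y; rewrite /preimage /=;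
  by rewrite (_ : shift_action t' (shift_action t y) = shift_action (t + t') y)//;
    apply: funext => s; rewrite /shift_action -addrA (addrC t').
have G0 : G 0.
  move=> A mA; congr m; apply/seteqP; split=> y; rewrite /preimage /=;
  by rewrite (_ : shift_action 0 y = y)//; apply: funext => s; rewrite /shift_action addr0.
have GN t : G t -> G (- t).
  move=> Gt A mA; rewrite -(Gt _ (mshift (- t) mA)).
  congr m; apply/seteqP; split=> y; rewrite /preimage /=;
  by rewrite (_ : shift_action (- t) (shift_action t y) = y)//;
    apply: funext => s; rewrite /shift_action subrK.
have Gunit i : G (unit_vec i).
  move=> A mA; set S := shift_action _.
  have mSA := mshift (unit_vec i) mA.
  have cd : `|avg n (S @^-1` A) - avg n A| @[n --> U] --> `|m (S @^-1` A) - m A|.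
    by apply: cvg_norm; apply: cvgB; exact: m_cvg.
  have c0 : (2 / n.+1%:R : R) @[n --> U] --> (0 : R).
    have c0' : (2 * n.+1%:R^-1 : R) @[n --> \oo] --> (2 * 0 : R).
      by apply: cvgM; [exact: cvg_cst|exact: cvg_harmonic].
    by move=> V V0; apply: Uoo; apply: c0'; rewrite mulr0.
  apply/eqP; rewrite -subr_eq0 -normr_le0; apply: (ler_cvg_to cd c0).
  apply: nearW => n.
  rewrite /avg (_ : mass A = fun s => mass (S @^-1` A) (s + unit_vec i)).
    rewrite average_translate; apply: average_increment; first by rewrite mem_enum.
    by move=> s; exact: mass_bound.
  by apply: funext => s; rewrite mass_shift.
have Gall t : G t.
  have GM u (k : nat) : G u -> G (u *+ k).
    by move=> Gu; elim: k => [//|k IH]; rewrite mulrS; exact: GD.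
  rewrite (row_sum_delta t); elim/big_ind: _ => // i _.
  rewrite -[t 0 i]intz scaler_int; case: (t 0 i) => k; first exact/GM/Gunit.
  by rewrite NegzE mulrNz; exact/GN/GM/Gunit.
have mY : measurable (Y : set (borel_config d spin)).
  apply: closed_measurable_config; exact: (spin_system_subshift d N.+1 b).1.
exists nu; split.
- split=> [|t E mE].
    rewrite nuE// (m_cst Y 1)// => s; rewrite /mass flip_system_preimage.
    by rewrite -pr_setI_setC// /pr mu_inv.1.
  by rewrite !nuE// ?Gall//; exact: mshift.
- by move=> A mA; rewrite prE// m_dom.
- move=> A x mA Ax; rewrite prE//; apply: m_le => // n.
  have hx (s : 'rV[int]_d) : (forall i, 0 <= s ord0 i) -> 0 <= mass A s <= x.
    by move=> s0; rewrite Ax// andbT; have /andP[] := mass_bound s mA.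
  pose nonneg (s : 'rV[int]_d) := forall i, 0 <= s ord0 i.
  have hD s i : nonneg s -> nonneg (s + unit_vec i).
    move=> s0 j; rewrite rowD; apply: addr_ge0; first exact: s0.
    by rewrite /unit_vec mxE; case: (_ && _).
  have h0 : nonneg 0 by move=> i; rewrite row0.
  by have := @average_bound _ _ n (enum 'I_d) _ nonneg _ _ hD hx 0 h0; case/andP.
Qed.
End Mixture.

(** * Entropy of the mixtures *)

Definition flip_pattern (d : nat) (S : {fset 'rV[int]_d}) (w : {ffun S -> spin}) :
  {ffun S -> spin} := [ffun s => omap negb (w s)].

Lemma flip_patternK (d : nat) (S : {fset 'rV[int]_d}) : involutive (@flip_pattern d S).
Proof.
by move=> w; apply/ffunP => s; rewrite !ffunE; case: (w s) => //= e; rewrite negbK.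
Qed.

Lemma flip_cylinder (d : nat) (S : {fset 'rV[int]_d}) (w : {ffun S -> spin}) :
  @flip d @^-1` cylinder w = cylinder (flip_pattern w).
Proof.
apply/seteqP; split=> y /= yw s; have := yw s; rewrite /flip ffunE.
  by move=> <-; case: (y (val s)) => //= e; rewrite negbK.
by move=> ->; case: (w s) => //= e; rewrite negbK.
Qed.

Lemma flip_language (d N b : nat) (S : {fset 'rV[int]_d}) (w : {ffun S -> spin}) :
  (flip_pattern w \in language S (@spin_system d N b)) =
  (w \in language S (@spin_system d N b)).
Proof.
have Yinv := (spin_system_subshift d N b).2.
have H u : u \in language S (@spin_system d N b) ->
    flip_pattern u \in language S (@spin_system d N b).
  move=> /(mem_language _ Yinv)[y [Yy yu]]; apply/(mem_language _ Yinv).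
  by exists (flip y); split=> [|s]; [exact: flip_spin_system|rewrite ffunE /flip yu].
by apply/idP/idP => /H; rewrite ?flip_patternK.
Qed.

(* nu is one of two measures with the same average as mu and its flip; averaging
   costs at most ln 2 of entropy, and the entropy of the other one is bounded by the
   topological entropy. *)
Lemma entropy_dominated (R : realType) (d N b : nat)
    (mu nu : probability (borel_config d spin) R) :
  let Y := @spin_system d N.+1 b in (0 < d)%N ->
  is_invariant_probability Y mu -> measure_entropy Y mu = top_entropy R Y ->
  is_invariant_probability Y nu ->
  (forall A : set (borel_config d spin), measurable A ->
     pr nu A <= pr mu A + pr mu (@flip d @^-1` A)) ->
  measure_entropy Y nu = top_entropy R Y.
Proof.
move=> Y d0 mu_inv mu_max nu_inv dom.
have top0 : 0 < top_entropy R Y := top_entropy_spin_gt0 R d N b.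
have Hl := top_entropy_cvg_cube (R := R) (spin_system_nonempty d N.+1 b)
  (spin_system_subshift d N.+1 b).2.
have H2 : 0 < measure_entropy Y mu by rewrite mu_max.
move/measure_entropy_cvg: H2; rewrite mu_max => Hmu.
have clY : closed Y := (spin_system_subshift d N.+1 b).1.
have sum1 (la : probability (borel_config d spin) R) S : la Y = 1%E ->
    \sum_(w in language S Y) pr la (cylinder w) = 1.
  move=> la1; have := pr_restr (S := S) xpredT clY la1.
  rewrite (_ : [set _ | _] = setT) ?pr_setT; last by apply/seteqP.
  by move=> ->; apply: eq_bigl => w; rewrite andbT.
pose H (la : probability (borel_config d spin) R) n :=
  \sum_(w in language (box (fun _ : 'I_d => n)) Y)
     - (pr la (cylinder w) * ln (pr la (cylinder w))).
pose L n : R := ln #|language (box (fun _ : 'I_d => n)) Y|%:R.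
have reflip n (f : R -> R) :
    \sum_(w in language (box (fun _ : 'I_d => n)) Y) f (pr mu (@flip d @^-1` cylinder w)) =
    \sum_(w in language (box (fun _ : 'I_d => n)) Y) f (pr mu (cylinder w)).
  rewrite (reindex_inj (inv_inj (@flip_patternK d (box (fun _ : 'I_d => n))))) /=.
  apply: eq_big => w; first exact: flip_language.
  by rewrite flip_cylinder flip_patternK.
(* The partner of [nu] enters only through its values on cylinders, which are nonnegative by
   [dom]. *)
have key n : 2 * H mu n <= H nu n + L n + 2 * ln 2.
  have := @entropy_mix R _ (language (box (fun _ : 'I_d => n)) Y)
    (fun w => pr mu (cylinder w)) (fun w => pr mu (@flip d @^-1` cylinder w))
    (fun w => pr nu (cylinder w))
    (fun w => pr mu (cylinder w) + pr mu (@flip d @^-1` cylinder w) - pr nu (cylinder w)).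
  rewrite (reflip n (fun x => - (x * ln x))) (reflip n id) -/(H mu n) -/(H nu n) -/(L n).
  have -> : 2 * H mu n = H mu n + H mu n by rewrite mulr_natl mulr2n.
  apply.
  - by move=> w; exact: pr_ge0.
  - by move=> w; exact: pr_ge0.
  - by move=> w; exact: pr_ge0.
  - by move=> w; rewrite subr_ge0; apply: dom; exact: cylinder_measurable.
  - by move=> w; rewrite [RHS]addrC subrK.
  - exact: sum1 mu_inv.1.
  - exact: sum1 mu_inv.1.
  - exact: sum1 nu_inv.1.
have upper n : H nu n <= L n.
  by apply: entropy_le_card (sum1 _ _ nu_inv.1) => w; exact: pr_ge0.
have d_cvg : (n%:R ^+ d)^-1 * (2 * ln 2) @[n --> \oo] --> (0 : R).
  have V_cvg : (n%:R ^+ d)^-1 @[n --> \oo] --> (0 : R).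
    rewrite -cvg_shiftS; apply: (cvg0_bound (e := @harmonic R)); last exact: cvg_harmonic.
    move=> n; rewrite invr_ge0 exprn_ge0//= lef_pV2 ?posrE ?exprn_gt0 ?ltr0n//.
    by rewrite -natrX ler_nat -{1}[n.+1]expn1 leq_pexp2l.
  by rewrite -[X in _ --> X](mul0r (2 * ln 2)); apply: cvgM; [exact: V_cvg|exact: cvg_cst].
have nu_cvg : (n%:R ^+ d)^-1 * H nu n @[n --> \oo] --> top_entropy R Y.
  (* Since [mu] is maximal, the lower bound [2 * H mu n - L n - 2 * ln 2] has the same normalised
     limit as the upper bound [L n]. *)
  have low : 2 * ((n%:R ^+ d)^-1 * H mu n) - (n%:R ^+ d)^-1 * L n
      - (n%:R ^+ d)^-1 * (2 * ln 2) @[n --> \oo] --> top_entropy R Y.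
    rewrite [X in _ --> X](_ : _ = 2 * top_entropy R Y - top_entropy R Y - 0); last by ring.
    by apply: cvgB => //; apply: cvgB => //; apply: cvgM => //; exact: cvg_cst.
  apply: (squeeze_cvgr _ low Hl); apply: nearW => n.
  have n0 : 0 <= (n%:R ^+ d)^-1 :> R by rewrite invr_ge0 exprn_ge0.
  apply/andP; split; last exact: ler_wpM2l.
  by have := ler_wpM2l n0 (key n); rewrite !mulrDr; lra.
exact: (cvg_lim (@Rhausdorff R) nu_cvg).
Qed.

(** Admissibility is essential: a cube with both signs would have [gsign] equal to 1 before and
    after the flip. *)
Lemma gsign_flip (d N c : nat) (y : config d spin) (s : 'rV[int]_d) :
  spin_system N (c + c) y -> gsign c (flip y) s = - gsign c y s.
Proof.
move=> Yy; have Fy := flip_spin_system Yy.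
have neg z : spin_system N (c + c) z -> gsign c z s = -1 -> gsign c (flip z) s = 1.
  move=> Yz zs; have nz : gsign c z s != 0 by rewrite zs.
  have [[] [t [st zt e]]] := gsign_nz nz; first by rewrite zs in e.
  by rewrite /gsign asboolT//; exists t; rewrite // /flip zt.
have nneg z : spin_system N (c + c) z -> gsign c z s = 1 -> gsign c (flip z) s = -1.
  move=> Yz zs; have nz : gsign c z s != 0 by rewrite zs.
  have [[] [t [st zt e]]] := gsign_nz nz; last by rewrite zs in e.
  have ft : flip z t = Some false by rewrite /flip zt.
  rewrite /gsign asboolF => [|[t' st' zt']]; first by rewrite asboolT//; exists t.
  have tt' : t <> t' by move=> e'; move: zt'; rewrite -e' ft.
  have := flip_spin_system Yz tt'; rewrite ft zt' => /(_ isT isT)/andP[_] /=.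
  move=> /negP; apply; apply/forallP => i.
  by have := forallP st i; have := forallP st' i; lia.
case: (eqVneq (gsign c y s) 0) => [y0|/gsign_nz[[] [_ [_ _ e]]]].
- rewrite y0 oppr0; apply/gsign_eq0 => t st; rewrite /flip.
  by move/gsign_eq0: y0 => ->.
- by rewrite nneg// e.
- by rewrite neg// e opprK.
Qed.

(** * Coexistence of two phases *)

Section TwoPhases.
Variables (R : realType) (d N q : nat).
Let c := (N.+1 + N.+1 + q)%N.
Let b := (c + c)%N.
Let Y := @spin_system d N.+1 b.
Let kappa : R := (2 ^ (2 ^ d))%:R / q%:R.
Hypothesis d1 : (1 < d)%N.
Hypothesis q0 : (0 < q)%N.
Hypothesis kappa_small : 9 * kappa <= 1 / 2.
Hypothesis eps_small : 2 * (2 * ((8 * d + 4)%:R * kappa)) + 2 * kappa < 1.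

Let sign_set (e : int) (s : 'rV[int]_d) : set (borel_config d spin) :=
  [set y | gsign c y s = e].

Let sign_measurable e s : measurable (sign_set e s).
Proof. exact: (gsign_measurable c (fun a _ => a = e) s s). Qed.

(** A unique measure of maximal entropy would equal both mixtures, so at the origin each sign would
    have probability at most [2 * ((8 * d + 4)%:R * kappa)]. An empty cube has probability at most
    [2 * kappa], and by [eps_small] these three do not add up to 1. *)
Lemma spin_system_not_intrinsically_ergodic : ~ intrinsically_ergodic R Y.
Proof.
move=> [mu [[mu_inv mu_max] uniq]].
have d0 : (0 < d)%N := ltnW d1.
have mY : measurable (Y : set (borel_config d spin)).
  apply: closed_measurable_config; exact: (spin_system_subshift d N.+1 b).1.
have muY : pr mu Y = 1 by rewrite /pr mu_inv.1.
have le_eps (A : set (borel_config d spin)) (s : 'rV[int]_d) : measurable A -> (forall i, 0 <= s ord0 i) ->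
    (forall y, A y -> Y y -> disagree c 0 s y) ->
    pr mu A <= (8 * d + 4)%:R * kappa.
  move=> mA s0 AD; apply: le_trans (pr_disagree_le d1 q0 kappa_small mu_inv mu_max s0).
  rewrite (pr_setI_full mA mY muY); apply: pr_le.
  - exact: measurableI.
  - exact: disagree_measurable.
  - by move=> y [Ay Yy]; exact: AD.
(* For the unique measure of maximal entropy, a mixture that rarely has the
   sign e at the origin shows that e is rare. *)
have phase (T : 'rV[int]_d -> set (borel_config d spin)) (e : int) :
    (forall s, measurable (T s)) ->
    (forall s t, shift_action t @^-1` T s = T (s + t)) ->
    (forall s y, sign_set e 0 y -> T s y -> disagree c 0 s y) ->
    (forall s y, sign_set (- e) 0 y -> ~ T s y -> disagree c 0 s y) ->
    pr mu (sign_set e 0) <= 2 * ((8 * d + 4)%:R * kappa).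
  move=> mT T_shift eT neT.
  have [nu [nu_inv dom bound]] := mixture mu_inv mT T_shift.
  have nu_max := entropy_dominated d0 mu_inv mu_max nu_inv dom.
  have -> : pr mu (sign_set e 0) = pr nu (sign_set e 0).
    by rewrite /pr (uniq nu).
  (* One term for the fields that are kept and one for those that are flipped: in both, the sign [e]
     at the origin after the operation means that the original signs at the origin and at [s]
     disagree. *)
  apply: bound => // s s0; rewrite mulr_natl mulr2n; apply: lerD.
    apply: (le_eps _ s) => //; first exact: measurableI.
    by move=> y [ey Ty] _; exact: eT.
  apply: (le_eps _ s) => //.
    apply: measurableI; last exact: measurableC.
    by apply: continuous_preimage_measurable => //; exact: flip_continuous.
  move=> y [ey Ty] Yy; apply: neT => //; move: ey; rewrite /sign_set /preimage /=.
  by rewrite (gsign_flip 0 Yy) => <-; rewrite opprK.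
have T_shift e s t : shift_action t @^-1` sign_set e s = sign_set e (s + t).
  by apply/seteqP; split=> y; rewrite /sign_set /preimage /= gsign_shift.
have minus : pr mu (sign_set (-1) 0) <= 2 * ((8 * d + 4)%:R * kappa).
  apply: (phase (sign_set 1)) => // s y; rewrite /sign_set /disagree /=.
    by move=> -> -> [].
  by rewrite opprK => -> ns [/esym].
(* The complementary rule flips exactly when the cube at [s] is +, so that the sign + becomes the
   rare one at the origin. *)
have plus : pr mu (sign_set 1 0) <= 2 * ((8 * d + 4)%:R * kappa).
  apply: (phase (fun s => ~` sign_set 1 s)) => [s|s t|s y|s y].
  - exact: measurableC.
  - by rewrite -T_shift.
  - by rewrite /sign_set /disagree /= => -> ns [/esym].
  - by rewrite /sign_set /disagree /= => -> /contrapT -> [].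
have zero : pr mu (sign_set 0 0) <= 2 * kappa.
  exact: (pr_unoccupied_le d1 q0 mu_inv mu_max 0).
have : pr mu setT <= \sum_(e <- [:: 1; -1; 0]) pr mu (sign_set e 0).
  apply: pr_cover => // y _; rewrite /sign_set /=.
  exists (gsign c y 0) => //; rewrite !inE /gsign.
  by case: asbool => //; case: asbool.
rewrite pr_setT !big_cons big_nil => le1.
suff : (1 : R) < 1 by rewrite ltxx.
apply: le_lt_trans eps_small; apply: le_trans le1 _.
move: plus minus zero; move: ((8 * d + 4)%:R * kappa) (kappa) => x k.
by move: (pr mu (sign_set 1 0)) (pr mu (sign_set (-1) 0)) (pr mu (sign_set 0 0)) => p m z; lra.
Qed.
End TwoPhases.

Theorem theorem1p1 (R : realType) (d : nat) (A : finType)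
  (X : set (config d A)) :
  (1 < d)%N ->
  X !=set0 ->
  is_subshift X ->
  Dstar_condition X ->
  ~ (exists x : config d A, (forall t, shift_action t x = x) /\ X = [set x]) ->
  exists (B : finPointedType) (phi : config d A -> config d B),
    [/\ is_factor_map X (phi @` X) phi,
        0 < top_entropy R (phi @` X)
      & ~ intrinsically_ergodic R (phi @` X)].
Proof.
move=> d1 X0 sX DX nfix.
have [N factor] := spin_factor (ltnW d1) X0 sX DX nfix.
(* This makes kappa equal to 1 / (100 d). *)
pose q := (100 * d * 2 ^ (2 ^ d))%N.
pose c := (N.+1 + N.+1 + q)%N.
have [phi phiX] := factor (c + c)%N.
have imX : phi @` X = @spin_system d N.+1 (c + c) by have [] := phiX.
have k0 : (0 < 2 ^ (2 ^ d))%N by rewrite expn_gt0.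
have d0 : (0 < d)%N := ltnW d1.
have q0 : (0 < q)%N by rewrite !muln_gt0 d0.
have kE : (2 ^ (2 ^ d))%:R / q%:R = (100 * d)%:R^-1 :> R.
  by rewrite /q natrM invfM mulrCA divff ?mulr1// pnatr_eq0 -lt0n.
have d_ge1 : 1 <= d%:R :> R by rewrite ler1n.
have kd : d%:R * (100 * d)%:R^-1 = 1 / 100 :> R.
  by rewrite natrM invfM mulrCA divff ?mulr1 ?mul1r// pnatr_eq0 -lt0n.
have k1 : 0 <= ((100 * d)%:R^-1 : R) <= 1 / 100.
  by rewrite invr_ge0 ler0n /= -kd ler_peMl ?invr_ge0.
exists spin, phi; rewrite imX; split; [by rewrite -imX in phiX *|exact: top_entropy_spin_gt0|].
(* The two conditions become [9 / (100 d) <= 1 / 2] and [(32 d + 18) / (100 d) < 1]. *)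
apply: (@spin_system_not_intrinsically_ergodic R d N q d1 q0); rewrite kE; first by lra.
by rewrite natrD natrM; move: kd k1; move: (_^-1) => k kd /andP[]; nra.
Qed.
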